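(* Suppose a system $\mathcal{S}=\{S_1,\dots,S_m\}$ of contracting similarities in $\mathbb{R}^n$ satisfies the weak separation property (WSP), and its attractor $K$ is a dendrite. Then for any $x\in K$, $\operatorname{Ord}(x,K)\le \mathcal{M}_{1/2}$.
   Context: The attractor of $\mathcal{S}$ is the unique nonempty compact $K$ with $K=\bigcup_{i=1}^m S_i(K)$. Let $I=\{1,\dots,m\}$, $I^*=\bigcup_{k\ge1}I^k$, and for $\mathbf{j}=j_1\dots j_k\in I^*$ let $S_{\mathbf j}=S_{j_1}\cdots S_{j_k}$ and $K_{\mathbf j}=S_{\mathbf j}(K)$. A dendrite is a locally connected continuum containing no simple closed curve. Weak separation property: let $\mathcal{F}=\{S_{\mathbf j}^{-1}S_{\mathbf i}:\mathbf{i},\mathbf{j}\in I^*\}$; WSP means $\mathrm{Id}\notin\overline{\mathcal{F}\setminus\{\mathrm{Id}\}}$, the closure being taken in the space of similarities of $\mathbb{R}^n$ with its usual topology (pointwise convergence). $\mathcal{M}_a$: writing $|A|$ for the diameter of a set $A$ and $r_{\min}$ for the smallest similarity ratio of $S_1,\dots,S_m$, for $a>0$ put $$\mathcal{M}_a=\sup_{U}\ \#\{S_{\mathbf j}:\ \mathbf j\in I^*,\ a|U|r_{\min}<|K_{\mathbf j}|\le a|U|,\ K_{\mathbf j}\cap U\ne\varnothing\},$$ where $U$ ranges over the nonempty bounded subsets of $\mathbb{R}^n$ and distinct maps $S_{\mathbf j}$ (not words) are counted. $\operatorname{Ord}(x,K)$ is the topological (Menger–Urysohn) order of $x$ in $K$: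 the least cardinal $\beta$ such that $x$ has arbitrarily small open neighborhoods in $K$ whose boundary in $K$ has cardinality at most $\beta$. *)

(* Defs.v *)
From HB Require Import structures.
From mathcomp Require Import all_boot all_order all_algebra.
From mathcomp Require Import all_classical all_reals all_analysis.
Import Order.TTheory GRing.Theory Num.Theory.
Import numFieldNormedType.Exports.

Set Implicit Arguments.
Unset Strict Implicit.
Unset Printing Implicit Defensive.

Local Open Scope classical_set_scope.
Local Open Scope card_scope.
Local Open Scope ring_scope.

(* A cardinal is represented by a set of that cardinality, and cardinals are
   compared with #<=.  Since every nonempty class of cardinals has a least
   element, the defining property of [least_card P] is satisfied as soon as P
   is nonempty. *)
Definition least_card (T : Type) (P : set (set T)) : set T :=
  get [set B | P B /\ forall C, P C -> B #<= C].

Section Euclidean.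
Variables (R : realType) (n : nat).
Notation E := 'rV[R]_n.
Implicit Types (A K U : set E) (f g : E -> E).

(* The library norm on 'rV_n is the sup norm: it induces the usual topology and
   the usual bounded sets, but lengths must be measured with the Euclidean
   distance. *)
Definition edist (x y : E) : R := Num.sqrt (\sum_(i < n) (x 0 i - y 0 i) ^+ 2).

(* Meant for bounded sets only ([sup] is 0 on unbounded ones). *)
Definition diam A : R := sup [set edist p.1 p.2 | p in A `*` A].

Definition similarity (r : R) f : Prop :=
  0 < r /\ forall x y, edist (f x) (f y) = r * edist x y.

Definition continuum K : Prop := [/\ K !=set0, compact K & connected K].

Definition locally_connected K : Prop :=
  forall x V, K x -> nbhs x V ->
  exists O, [/\ open O, O x, K `&` O `<=` V & connected (K `&` O)].

Definition contains_simple_closed_curve K : Prop :=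
  exists c : R -> E,
    [/\ {within `[0, 1], continuous c}, c 0 = c 1,
        {in `[0, 1[ &, injective c} & c @` `[0, 1] `<=` K].

Definition dendrite K : Prop :=
  [/\ continuum K, locally_connected K & ~ contains_simple_closed_curve K].

Definition boundary_in K A : set E := K `&` closure A `&` closure (K `\` A).

(* Menger-Urysohn order.  The open sets of K are the K `&` O with O open.  All
   boundaries are subsets of E, so no smaller cardinal is missed by letting B
   range over the subsets of E. *)
Definition menger_order K (x : E) : set E :=
  least_card [set B : set E | forall V, nbhs x V ->
    exists O, [/\ open O, O x, K `&` O `<=` V
                & boundary_in K (K `&` O) #<= B]].

Section System.
Variables (m : nat) (S : 'I_m -> E -> E).

Definition word_map (w : seq 'I_m) : E -> E :=
  foldr (fun i f => S i \o f) idfun w.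

Definition attractor K : Prop :=
  [/\ K !=set0, compact K & K = \bigcup_(i in [set: 'I_m]) (S i @` K)].

(* The maps S_j^-1 S_i, over nonempty words; T is the inverse of S_j (which
   exists, as every similarity of R^n is bijective). *)
Definition quotient_maps : set (E -> E) :=
  [set g | exists i j T,
    [/\ i != [::], j != [::], cancel T (word_map j), cancel (word_map j) T
      & g = T \o word_map i]].

(* The identity and all quotient maps are similarities, so the closure may as
   well be taken in the space of all maps with pointwise convergence. *)
Definition weak_separation : Prop :=
  ~ closure (quotient_maps `\ idfun : set {ptws E -> E}) idfun.

(* The maps (not the words) counted in M_a for a given U; [inf (range r)] is
   the smallest ratio, since the range is finite. *)
Definition maps_meeting (r : 'I_m -> R) K (a : R) U : set (E -> E) :=
  [set word_map j | j in [set j : seq 'I_m |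
    [/\ j != [::],
        a * diam U * inf (range r) < diam (word_map j @` K) <= a * diam U
      & (word_map j @` K) `&` U !=set0]]].

(* The supremum over U is the least upper bound of the cardinals. *)
Definition calM (r : 'I_m -> R) K (a : R) : set (E -> E) :=
  least_card [set B : set (E -> E) | forall U, U !=set0 -> bounded_set U ->
    maps_meeting r K a U #<= B].

End System.
End Euclidean.

(* Main.v *)
Require Import Defs.
From mathcomp Require Import all_boot all_order all_algebra.
From mathcomp Require Import all_classical all_reals all_analysis.
From mathcomp Require Import ring lra.
Import Order.TTheory GRing.Theory Num.Theory.
Import numFieldNormedType.Exports.
Local Open Scope classical_set_scope.
Local Open Scope card_scope.
Local Open Scope ring_scope.

(* Fix x in K and a small neighbourhood V of x.  Only finitely many path
   components of K \ {x} leave V, and since K contains no simple closed curve,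
   an interior point of an arc from x into such a component C cuts K; taken
   close enough to x, it cuts x from the part of C outside V.  Hence x has a
   neighbourhood inside V whose boundary consists of at most one point of each
   component leaving V.  Conversely each such component crosses every small
   sphere of radius s around x; if s is not the diameter of a piece, then the
   pieces of diameter between r_min d/2 and d/2, where d <= 2 s is the diameter
   of the part of K in the ball, do not contain x when they touch the sphere, so
   they are contained in one component each, and there are at least as many of
   them as of those components.  Paths in K are limits of concatenations of
   segments along chains of pieces, and arcs are extracted from them. *)

Set Implicit Arguments.
Unset Strict Implicit.
Unset Printing Implicit Defensive.

(* The library has another [edist], on pseudometric spaces. *)
Local Notation edist := Defs.edist.

(** * Least cardinals *)

(** If some member of [P] is finite, take one of least size; otherwise every member is infinite, so
    the countable [B] embeds in each of them. Countability of [B] replaces the well-ordering of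
    cardinals. *)
Lemma least_cardP (T : Type) (P : set (set T)) (B : set T) :
  P B -> countable B ->
  P (least_card P) /\ forall C, P C -> least_card P #<= C.
Proof.
move=> PB cB; rewrite /least_card.
suff [A PA] : [set A | P A /\ forall C, P C -> A #<= C] !=set0.
  by case: xgetP => [_ -> //|/(_ A)].
have infle (C : set T) : ~ finite_set C -> [set: nat] #<= C by move/infiniteP.
have [[n [A [PA An]]]|nfin] := pselect (exists n (A : set T), P A /\ A #= `I_n).
  pose Q k := `[< exists A : set T, P A /\ A #= `I_k >].
  have exQ : exists k, Q k by exists n; apply/asboolP; exists A.
  case: (ex_minnP exQ) => k /asboolP[A' [PA' A'k]] kmin.
  exists A'; split=> // C PC.
  have [/finite_setP[j Cj]|/infle] := pselect (finite_set C).
    rewrite (card_le_eql A'k) (card_le_eqr Cj) card_le_II.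
    by apply: kmin; apply/asboolP; exists C.
  by apply: card_le_trans; rewrite (card_le_eql A'k); exact: card_leT.
exists B; split=> // C PC; apply: (card_le_trans cB).
by apply: infle => /finite_setP[j Cj]; apply: nfin; exists j, C.
Qed.

(** * The Euclidean distance and its comparison with the sup norm *)

Section Euclid.
Variables (R : realType) (n : nat).
Notation E := 'rV[R]_n.
Implicit Types x y z : E.

Lemma eucl_ge0 x y : 0 <= edist x y.
Proof. exact: sqrtr_ge0. Qed.

Lemma euclC x y : edist x y = edist y x.
Proof.
rewrite /edist; congr Num.sqrt; apply: eq_bigr => i _.
by rewrite -sqrrN opprB.
Qed.

Lemma euclxx x : edist x x = 0.
Proof. by rewrite /edist big1 ?sqrtr0 // => i _; rewrite subrr expr0n. Qed.

(** Expanding the nonnegative sum of the squares of [t * a i - s * b i], with [s] and [t] the two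
    norms, gives the bound multiplied by [2 * s * t]; a zero norm is treated apart. *)
Lemma sum_cauchy_schwarz (I : finType) (a b : I -> R) :
  \sum_i a i * b i <=
    Num.sqrt (\sum_i a i ^+ 2) * Num.sqrt (\sum_i b i ^+ 2).
Proof.
set A := \sum_i a i ^+ 2; set B := \sum_i b i ^+ 2.
have A0 : 0 <= A by apply: sumr_ge0 => i _; exact: sqr_ge0.
have B0 : 0 <= B by apply: sumr_ge0 => i _; exact: sqr_ge0.
set s := Num.sqrt A; set t := Num.sqrt B.
have s2 : s ^+ 2 = A by rewrite sqr_sqrtr.
have t2 : t ^+ 2 = B by rewrite sqr_sqrtr.
have s0 : 0 <= s by exact: sqrtr_ge0.
have t0 : 0 <= t by exact: sqrtr_ge0.
have zero (c : I -> R) : Num.sqrt (\sum_i c i ^+ 2) = 0 -> forall i, c i = 0.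
  move=> /eqP; rewrite sqrtr_eq0 => c0 i; apply/eqP; rewrite -sqrf_eq0.
  have C0 : \sum_i c i ^+ 2 == 0.
    by rewrite eq_le c0 sumr_ge0// => j _; exact: sqr_ge0.
  move: C0; rewrite psumr_eq0; last by move=> j _; exact: sqr_ge0.
  by move=> /allP/(_ i); rewrite mem_index_enum => /(_ isT).
have [s00|sn0] := eqVneq s 0.
  by rewrite s00 mul0r big1// => i _; rewrite (zero _ s00) mul0r.
have [t00|tn0] := eqVneq t 0.
  by rewrite t00 mulr0 big1// => i _; rewrite (zero _ t00) mulr0.
have st : 0 < s * t by rewrite mulr_gt0// lt_def ?sn0 ?tn0.
have : 0 <= \sum_i (t * a i - s * b i) ^+ 2.
  by apply: sumr_ge0 => i _; exact: sqr_ge0.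
have -> : \sum_i (t * a i - s * b i) ^+ 2 =
    t ^+ 2 * A - 2 * (s * t) * (\sum_i a i * b i) + s ^+ 2 * B.
  rewrite /A /B !mulr_sumr -sumrB -big_split/=.
  by apply: eq_bigr => i _; ring.
rewrite -s2 -t2; set X := \sum_i a i * b i => h.
by rewrite -(ler_pM2l st); lra.
Qed.

Lemma eucl_triangle y x z : edist x z <= edist x y + edist y z.
Proof.
have sq (a b : E) : 0 <= edist a b by exact: eucl_ge0.
rewrite -(ler_pXn2r (n := 2)) ?nnegrE ?addr_ge0//.
have e2 (a b : E) : edist a b ^+ 2 = \sum_(i < n) (a 0 i - b 0 i) ^+ 2.
  by rewrite sqr_sqrtr// sumr_ge0// => i _; exact: sqr_ge0.
have := sum_cauchy_schwarz (fun i => x 0 i - y 0 i) (fun i => y 0 i - z 0 i).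
rewrite -!/(edist _ _) => cs.
rewrite sqrrD !e2.
have -> : \sum_(i < n) (x 0 i - z 0 i) ^+ 2 =
  \sum_(i < n) (x 0 i - y 0 i) ^+ 2 +
    (\sum_(i < n) (x 0 i - y 0 i) * (y 0 i - z 0 i)) *+ 2 +
  \sum_(i < n) (y 0 i - z 0 i) ^+ 2.
  by rewrite -mulr_natl mulr_sumr -!big_split/=; apply: eq_bigr => i _; ring.
by rewrite lerD2r lerD2l lerMn2r.
Qed.

Lemma coord_le_eucl x y i : `|x 0 i - y 0 i| <= edist x y.
Proof.
rewrite -sqrtr_sqr; apply: ler_wsqrtr.
by rewrite (bigD1 i)//= lerDl sumr_ge0// => j _; exact: sqr_ge0.
Qed.

Lemma norm_le_eucl x y : `|x - y| <= edist x y.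
Proof.
rewrite [`|_|]mx_normrE; apply/bigmax_leP; split=> /=.
  exact: eucl_ge0.
by move=> [i j] _ /=; rewrite !mxE ord1; exact: coord_le_eucl.
Qed.

Lemma eucl_le_norm x y : edist x y <= n%:R * `|x - y|.
Proof.
rewrite /edist; set s := \sum_(i < n) _.
have nx : 0 <= n%:R * `|x - y| by rewrite mulr_ge0.
rewrite -(ger0_norm nx) -sqrtr_sqr; apply: ler_wsqrtr.
have : s <= \sum_(i < n) `|x - y| ^+ 2.
  apply: ler_sum => i _; rewrite -real_normK ?num_real//.
  rewrite ler_pXn2r ?nnegrE//.
  have -> : x 0 i - y 0 i = (x - y) 0 i by rewrite !mxE.
  rewrite [leRHS]mx_normrE.
  exact: (le_bigmax _ (fun p : 'I_1 * 'I_n => `|(x - y) p.1 p.2|) (ord0, i)).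
rewrite sumr_const card_ord -[X in _ <= X]mulr_natl => /le_trans; apply.
rewrite exprMn; apply: ler_wpM2r; first exact: sqr_ge0.
rewrite -natrX ler_nat.
by case: (n) => // k; rewrite leq_pmulr.
Qed.

Lemma eucl_lip x y z : `|edist x z - edist y z| <= n%:R * `|x - y|.
Proof.
apply: le_trans (eucl_le_norm x y).
have := eucl_triangle y x z; have := eucl_triangle x y z.
by rewrite (euclC y x) ler_norml; lra.
Qed.

End Euclid.

(** * Paths *)

Section Paths.
Variables (R : realType) (n : nat).
Notation E := 'rV[R]_n.
Implicit Types (G : set E) (a b c x y z : E) (g : R -> E).

(** The retraction of the line onto [[0, 1]], written with absolute values so that its continuity is
    immediate. *)
Definition clamp (t : R) : R := (`|t| - `|t - 1| + 1) / 2.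

Lemma clamp_id t : 0 <= t <= 1 -> clamp t = t.
Proof.
move=> /andP[t0 t1]; rewrite /clamp (ger0_norm t0) ler0_norm; first by lra.
lra.
Qed.

Lemma clamp_le0 t : t <= 0 -> clamp t = 0.
Proof.
move=> t0; rewrite /clamp (ler0_norm t0) ler0_norm; first by lra.
lra.
Qed.

Lemma clamp_ge1 t : 1 <= t -> clamp t = 1.
Proof.
move=> t0; rewrite /clamp !ger0_norm; first by lra.
  lra.
lra.
Qed.

Lemma clamp_bound t : 0 <= clamp t <= 1.
Proof.
case: (leP t 0) => [/clamp_le0 ->|t0]; first by rewrite lexx ler01.
case: (leP 1 t) => [/clamp_ge1 ->|t1]; first by rewrite lexx ler01.
by rewrite clamp_id; lra.
Qed.

Lemma clamp_continuous : continuous clamp.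
Proof.
move=> t; apply: cvgMl; apply: cvgD; last exact: cvg_cst.
apply: cvgB; apply: cvg_norm; first exact: cvg_id.
by apply: cvgB; [exact: cvg_id|exact: cvg_cst].
Qed.

Lemma affine_continuous (s t : R) : continuous (fun u : R => s + u * t).
Proof.
by move=> u; apply: cvgD; [exact: cvg_cst|apply: cvgMl; exact: cvg_id].
Qed.

Lemma cont_comp (T U V : topologicalType) (f : T -> U) (h : U -> V) :
  continuous f -> continuous h -> continuous (fun u => h (f u)).
Proof.
by move=> cf ch u; apply: continuous_comp; [exact: cf|exact: ch].
Qed.

(** Paths are parametrised by the whole line and stay in [G] at all times, so continuity is never
    relative to an interval; [clamp] brings a path over a segment into this form. *)
Definition joined G a b := exists g,
  [/\ continuous g, g 0 = a, g 1 = b & forall t, G (g t)].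

Lemma joined_refl G a : G a -> joined G a a.
Proof. by exists (fun=> a); split=> // t; exact: cvg_cst. Qed.

Lemma joined_sym G a b : joined G a b -> joined G b a.
Proof.
move=> [g [cg g0 g1 Gg]]; exists (fun t => g (1 + t * -1)); split=> //.
- apply: (@cont_comp _ _ _ (fun t : R => 1 + t * -1) g) => //.
  exact: affine_continuous.
- by rewrite mul0r addr0.
- by rewrite mul1r subrr.
Qed.

Lemma joined_sub G G' a b : G `<=` G' -> joined G a b -> joined G' a b.
Proof. by move=> GG' [g [? ? ? Gg]]; exists g; split=> // t; exact/GG'/Gg. Qed.

Lemma joined_mem G a b : joined G a b -> G a /\ G b.
Proof. by move=> [g [_ <- <- Gg]]; split; exact: Gg. Qed.

Lemma joined_segment G g (s t : R) : continuous g ->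
  (forall u, Num.min s t <= u <= Num.max s t -> G (g u)) -> joined G (g s) (g t).
Proof.
move=> cg Gg; exists (fun u => g (s + clamp u * (t - s))); split.
- apply: (@cont_comp _ _ _ (fun u => s + clamp u * (t - s)) g) => //.
  exact: (@cont_comp R R R _ _ clamp_continuous (@affine_continuous s (t - s))).
- by rewrite clamp_le0// mul0r addr0.
- by rewrite clamp_ge1// mul1r addrC subrK.
- move=> u; apply: Gg; have /andP[] := clamp_bound u.
  set c := clamp u => c0 c1.
  by case: (leP s t) => st; apply/andP; split; nra.
Qed.

Lemma joined_image (f : E -> E) G a b :
  continuous f -> joined G a b -> joined (f @` G) (f a) (f b).
Proof.
move=> cf [g [cg <- <- Gg]]; exists (f \o g); split=> //.
- exact: (cont_comp cg cf).
- by move=> t; exists (g t).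
Qed.

(** On each half of the time interval one of the two moving terms rests at [g 1] or at [h 0], and
    [- g 1] cancels it when [g 1 = h 0]. A single formula makes continuity immediate, without
    pasting. *)
Definition concat g h (t : R) : E := g (clamp (2 * t)) + h (clamp (2 * t - 1)) - g 1.

Lemma concatE1 g h t : g 1 = h 0 -> t <= 1/2 ->
  concat g h t = g (clamp (2 * t)).
Proof.
move=> gh th; rewrite /concat (@clamp_le0 (2 * t - 1)); last by lra.
by rewrite -gh addrK.
Qed.

Lemma concatE2 g h t : 1/2 <= t ->
  concat g h t = h (clamp (2 * t - 1)).
Proof.
move=> th; rewrite /concat (@clamp_ge1 (2 * t)); last by lra.
by rewrite addrC addKr.
Qed.

Lemma concat_continuous g h :
  continuous g -> continuous h -> continuous (concat g h).
Proof.
move=> cg ch; rewrite /concat => t; apply: cvgB; last exact: cvg_cst.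
have cl (p q : R) : continuous (fun t : R => clamp (p * t + q)).
  apply: (@cont_comp _ _ _ (fun t => p * t + q) clamp); last exact: clamp_continuous.
  by move=> u; apply: cvgD; [apply: cvgMr; exact: cvg_id|exact: cvg_cst].
apply: cvgD; last exact: (cont_comp (cl 2 (-1)) ch).
have := cont_comp (cl 2 0) cg; under eq_fun do rewrite addr0.
exact.
Qed.

Lemma concat0 g h : g 1 = h 0 -> concat g h 0 = g 0.
Proof. by move=> gh; rewrite concatE1// ?mulr0 ?clamp_le0//; lra. Qed.

Lemma concat1 g h : concat g h 1 = h 1.
Proof.
rewrite concatE2; last by lra.
by rewrite clamp_ge1//; lra.
Qed.

Lemma joined_trans G b a c : joined G a b -> joined G b c -> joined G a c.
Proof.
move=> [g [cg g0 g1 Gg]] [h [ch h0 h1 Gh]].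
have gh : g 1 = h 0 by rewrite g1.
exists (concat g h); split.
- exact: concat_continuous.
- by rewrite concat0.
- by rewrite concat1.
- move=> t; case: (leP t (1/2)) => th; first by rewrite concatE1.
  by rewrite concatE2//; exact: ltW.
Qed.

End Paths.

(** * Uniform limits of paths with geometric increments *)

Section GeometricLimit.
Variables (R : realType) (V : normedModType R).
Hypothesis completeV : forall F : set_system V,
  ProperFilter F -> cauchy F -> cvg F.
Variables (C q : R) (f : nat -> R -> V).
Hypotheses (C0 : 0 <= C) (q0 : 0 <= q) (q1 : q < 1).
Hypothesis df : forall k t, `|f k.+1 t - f k t| <= C * q ^+ k.

Let dfm k j t : `|f (k + j)%N t - f k t| <= C * q ^+ k / (1 - q).
Proof.
have q1' : 0 < 1 - q by rewrite subr_gt0.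
have qk i : 0 <= q ^+ i by exact: exprn_ge0.
suff : `|f (k + j)%N t - f k t| <= C * (q ^+ k - q ^+ (k + j)) / (1 - q).
  move=> /le_trans; apply; rewrite ler_pM2r ?invr_gt0//.
  by apply: ler_wpM2l => //; rewrite gerBl.
elim: j => [|j IH]; first by rewrite addn0 !subrr normr0 mulr0 mul0r.
have -> : f (k + j.+1)%N t - f k t =
    (f (k + j).+1 t - f (k + j)%N t) + (f (k + j)%N t - f k t).
  by rewrite addnS addrA subrK.
apply: (le_trans (ler_normD _ _)); apply: (le_trans (lerD (df _ _) IH)).
rewrite addnS exprS -subr_ge0.
set A := q ^+ (k + j); set B := q ^+ k.
suff -> : C * (B - q * A) / (1 - q) - (C * A + C * (B - A) / (1 - q)) = 0 by [].
by field; rewrite gt_eqF.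
Qed.

Let small (e : R) : 0 < e -> exists k, C * q ^+ k / (1 - q) < e.
Proof.
move=> e0.
have q1' : 0 < 1 - q by rewrite subr_gt0.
have : C / (1 - q) * q ^+ k @[k --> \oo] --> C / (1 - q) * 0.
  by apply: cvgMr; apply: cvg_expr; rewrite ger0_norm.
rewrite mulr0 => /cvgrPdist_lt/(_ _ e0)[N _ /(_ N (leqnn _))] /=.
rewrite sub0r normrN => h; exists N; move: h; rewrite mulrAC.
by apply: le_lt_trans; exact: ler_norm.
Qed.

(** The tail of the geometric series bounds the distance from [f k t] to its limit uniformly in [t],
    so continuity passes to the limit by the usual [e / 3] argument. *)
Lemma geometric_limit : (forall k, continuous (f k)) ->
  exists g, continuous g /\ forall t, f k t @[k --> \oo] --> g t.
Proof.
move=> cf.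
have cv t : exists l : V, f k t @[k --> \oo] --> l.
  have /completeV : cauchy (f k t @[k --> \oo]).
    apply: cauchy_exP => e e0; have [k ke] := small e0.
    exists (f k t); exists k => // j /= kj.
    rewrite -ball_normE/= -(subnKC kj) distrC.
    exact: le_lt_trans (dfm _ _ _) ke.
  by move=> /cvg_ex[l hl]; exists l.
have [g gP] := choice cv; exists g; split=> //.
have gk k t : `|g t - f k t| <= C * q ^+ k / (1 - q).
  have : f j t - f k t @[j --> \oo] --> g t - f k t.
    by apply: cvgB; [exact: gP|exact: cvg_cst].
  move=> /cvg_norm; apply: (@closed_cvg _ _ _ _ _ [set x | x <= _]).
    exact: closed_le.
  by exists k => // j /= kj; rewrite -(subnKC kj).
move=> t; apply/cvgrPdist_lt => e e0.
have e3 : 0 < e / 3 by rewrite divr_gt0.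
have [k ke] := small e3.
have /cvgrPdist_lt/(_ _ e3) := cf k t; apply: filterS => s h.
have -> : g t - g s = (g t - f k t) + (f k t - f k s) + (f k s - g s).
  by rewrite !subrKA.
have a1 := gk k t; have a2 := gk k s; rewrite distrC in a2.
have b1 := ler_normD (g t - f k t + (f k t - f k s)) (f k s - g s).
have b2 := ler_normD (g t - f k t) (f k t - f k s).
lra.
Qed.

End GeometricLimit.

(** * Path-connectedness of the attractor *)

Section Pieces.
Variables (R : realType) (n m : nat) (r : 'I_m -> R).
Variables (S : 'I_m -> 'rV[R]_n -> 'rV[R]_n) (K : set 'rV[R]_n).
Notation E := 'rV[R]_n.
Hypothesis simS : forall i, similarity (r i) (S i) /\ r i < 1.
Hypothesis attrK : attractor S K.
Implicit Types (a b c x y z : E) (l : seq ('I_m * (E * E))) (w : seq 'I_m).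

Let r_gt0 i : 0 < r i. Proof. by have [[]] := simS i. Qed.

Let edistS i x y : edist (S i x) (S i y) = r i * edist x y.
Proof. by have [[_]] := simS i. Qed.

Lemma similarity_continuous (f : E -> E) (s : R) : similarity s f -> continuous f.
Proof.
move=> [s0 fs] x; apply/(@cvgrPdist_lt _ _ _ _ (nbhs_filter x)) => e e0.
have c0 : 0 < s * n%:R + 1 by rewrite ltr_wpDl// mulr_ge0// ltW.
have : 0 < e / (s * n%:R + 1) by rewrite divr_gt0.
move=> /(nbhsx_ballx x); apply: (@filterS _ _ (nbhs_filter x)) => y /=.
rewrite -ball_normE/= ltr_pdivlMr// => xy.
apply: le_lt_trans (norm_le_eucl _ _) _; rewrite fs.
apply: le_lt_trans xy; rewrite mulrDr mulr1 ler_wpDr//.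
by rewrite mulrCA ler_pM2l// mulrC eucl_le_norm.
Qed.

Lemma S_continuous i : continuous (S i).
Proof. by have [s _] := simS i; exact: similarity_continuous s. Qed.

Let compK : compact K. Proof. by have [] := attrK. Qed.

Let KS i x : K x -> K (S i x).
Proof. by move=> Kx; have [_ _ ->] := attrK; exists i => //; exists x. Qed.

Let KE y : K y -> exists i x, K x /\ y = S i x.
Proof.
by have [_ _ {1}->] := attrK => -[i _ [x Kx <-]]; exists i, x.
Qed.

Lemma compact_edist_bound (A : set E) : compact A ->
  exists D, 0 <= D /\ forall a b, A a -> A b -> n%:R * `|a - b| <= D.
Proof.
move=> /compact_bounded/= [M [_ hM]].
have {}hM x : A x -> `|x| <= `|M| + 1.
  move=> Ax; apply: (hM (`|M| + 1)) => //.
  by apply: le_lt_trans (ler_norm _) _; rewrite ltrDl.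
exists (n%:R * (2 * (`|M| + 1))); split=> [|a b Aa Ab].
  by rewrite !mulr_ge0// addr_ge0.
apply: ler_wpM2l => //; apply: le_trans (ler_normB _ _) _.
by have := hM _ Aa; have := hM _ Ab; lra.
Qed.

Lemma ratio_bound : exists q, [/\ 0 <= q, q < 1 & forall i, r i <= q].
Proof.
exists (\big[Num.max/0]_i r i); split.
- by elim/big_rec: _ => // i x _ x0; rewrite le_max x0 orbT.
- by apply/bigmax_ltP; split=> // i _; have [] := simS i.
- by move=> i; exact: (le_bigmax _ (fun i => r i)).
Qed.

Lemma closed_piece i : closed (S i @` K).
Proof.
apply: compact_closed; first exact: norm_hausdorff.
apply: continuous_compact compK.
by apply: continuous_subspaceT; exact: S_continuous.
Qed.

(** An entry [(i, (p, q))] is a link from [S i p] to [S i q] inside one first-level piece of [K]. *)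
Fixpoint is_chain a b l : Prop := if l is p :: l' then
  [/\ K p.2.1, K p.2.2, S p.1 p.2.1 = a & is_chain (S p.1 p.2.2) b l']
  else a = b.

Lemma is_chain_cat a b c l l' :
  is_chain a b l -> is_chain b c l' -> is_chain a c (l ++ l').
Proof.
elim: l a => [a /= -> //|p l IH a /= [? ? ? h] h']; split=> //; exact: IH.
Qed.

(** The set of points reachable from [a] is a union of whole pieces, because two points of one piece
    form a single link. The pieces are closed and finitely many, so this set is both open and closed
    in [K]. *)
Lemma chain_exists a b : connected K -> K a -> K b -> exists l, is_chain a b l.
Proof.
move=> conK Ka Kb; pose A := [set y | K y /\ exists l, is_chain a y l].
suff AK : A = K by have [] : A b by rewrite AK.
pose J i := exists p, K p /\ A (S i p).
have AJ i p : J i -> K p -> A (S i p).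
  move=> [p' [Kp' [_ [l hl]]]] Kp; split; first exact: KS.
  exists (l ++ [:: (i, (p', p))]); apply: (is_chain_cat hl) => /=.
  by split.
apply: conK; first by exists a; split=> //; exists [::].
- exists (~` \bigcup_(i in [set i | ~ J i]) (S i @` K)).
    rewrite openC; apply: closed_bigcup; first exact: finite_finset.
    by move=> i _; exact: closed_piece.
  apply/seteqP; split=> [y Ay|y [Ky nJ]].
    by split; [exact: Ay.1|]; move=> -[i /= nJi [p Kp py]]; apply: nJi;
      exists p; rewrite py.
  have [i [p [Kp yp]]] := KE Ky; rewrite yp; apply: (AJ i p) => //.
  by apply: contrapT => nJi; apply: nJ; exists i => //; exists p.
- exists (\bigcup_(i in [set i | J i]) (S i @` K)).
    apply: closed_bigcup; first exact: finite_finset.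
    by move=> i _; exact: closed_piece.
  apply/seteqP; split=> [y Ay|y [Ky [i /= Ji [p Kp <-]]]]; last exact: AJ.
  split; [exact: Ay.1|]; have [i [p [Kp yp]]] := KE Ay.1.
  by exists i; [exists p; rewrite -yp|exists p].
Qed.

Definition chain a b := xget [::] [set l | is_chain a b l].

Fixpoint glue (F : E -> E -> R -> E) b l : R -> E :=
  if l is p :: l' then concat (fun t => S p.1 (F p.2.1 p.2.2 t)) (glue F b l')
  else fun=> b.

(** Level 0 is the straight segment, which may leave [K]; each further level follows the chosen
    chain and fills every link with the image under [S i] of a path of the previous level. *)
Fixpoint approx k a b : R -> E :=
  if k is k'.+1 then glue (approx k') b (chain a b)
  else fun t => a + clamp t *: (b - a).

Definition pathlike (F : E -> E -> R -> E) := forall p q, K p -> K q ->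
  [/\ continuous (F p q), F p q 0 = p & F p q 1 = q].

Lemma glue_pathlike F a b l : pathlike F -> is_chain a b l ->
  [/\ continuous (glue F b l), glue F b l 0 = a & glue F b l 1 = b].
Proof.
move=> PF; elim: l a => [a /= ->|p l IH a /= [Kp Kq pa /IH[cl l0 l1]]].
  by split=> // t; exact: cvg_cst.
have [cF F0 F1] := PF _ _ Kp Kq.
split.
- by apply: concat_continuous => //; exact: (cont_comp cF (@S_continuous p.1)).
- by rewrite concat0 /= ?F0 ?F1.
- by rewrite concat1.
Qed.

Lemma glue_ind F (P : E -> Prop) a b l : pathlike F -> is_chain a b l -> P b ->
  (forall i p q u, K p -> K q -> P (S i (F p q u))) ->
  forall t, P (glue F b l t).
Proof.
move=> PF + Pb PS; elim: l a => [//|p l IH a /= [Kp Kq pa hl] t].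
have [_ _ F1] := PF _ _ Kp Kq; have [_ g0 _] := glue_pathlike PF hl.
case: (leP t (1/2)) => th.
  by rewrite concatE1 /= ?F1 ?g0 //; exact: PS.
by rewrite concatE2; [exact: IH hl _|exact: ltW].
Qed.

(** Both glued paths traverse the same link at the same time, so they can be compared link by
    link. *)
Lemma glue_ind2 F F' (P : E -> E -> Prop) a b l : pathlike F -> pathlike F' ->
  is_chain a b l -> P b b ->
  (forall i p q u, K p -> K q -> P (S i (F p q u)) (S i (F' p q u))) ->
  forall t, P (glue F b l t) (glue F' b l t).
Proof.
move=> PF PF' + Pb PS; elim: l a => [//|p l IH a /= [Kp Kq pa hl] t].
have [_ _ F1] := PF _ _ Kp Kq; have [_ g0 _] := glue_pathlike PF hl.
have [_ _ F1'] := PF' _ _ Kp Kq; have [_ g0' _] := glue_pathlike PF' hl.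
case: (leP t (1/2)) => th.
  by rewrite !concatE1 /= ?F1 ?F1' ?g0 ?g0' //; exact: PS.
by rewrite !concatE2; [exact: IH hl _|exact: ltW|exact: ltW].
Qed.

Hypothesis conK : connected K.

Lemma chainP a b : K a -> K b -> is_chain a b (chain a b).
Proof.
move=> Ka Kb; have [l hl] := chain_exists conK Ka Kb.
by rewrite /chain; case: xgetP => [_ -> //|/(_ l)].
Qed.

Lemma approx_pathlike k : pathlike (approx k).
Proof.
elim: k => [|k IH] p q Kp Kq /=; last exact/(glue_pathlike IH)/chainP.
split.
- move=> t; apply: cvgD; first exact: cvg_cst.
  by apply: cvgZr_tmp; exact: clamp_continuous.
- by rewrite clamp_le0// scale0r addr0.
- by rewrite clamp_ge1// scale1r addrC subrK.
Qed.

(** Each level contracts the previous one, so the paths of level [k] stay within [q ^+ k * D] of [K]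
    and change by at most [3 * D * q ^+ k] at the next level. They converge uniformly, and the limit
    lies in the closed set [K]. *)
Lemma K_joined a b : K a -> K b -> joined K a b.
Proof.
have [q [q0 q1 rq]] := ratio_bound.
have [D [D0 KD]] := compact_edist_bound compK.
have near k p p' t : K p -> K p' ->
    exists2 y, K y & edist (approx k p p' t) y <= q ^+ k * D.
  elim: k p p' t => [|k IH] p p' t Kp Kp' /=.
    exists p => //; rewrite mul1r; apply: le_trans (eucl_le_norm _ _) _.
    rewrite addrC addKr normrZ; apply: le_trans (KD _ _ Kp' Kp).
    apply: ler_wpM2l => //; rewrite ler_piMl//.
    by have /andP[? ?] := clamp_bound t; rewrite ger0_norm.
  apply: (glue_ind (P := fun z => exists2 y, K y & edist z y <= q ^+ k.+1 * D)
    (@approx_pathlike k) (chainP Kp Kp')).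
    by exists p' => //; rewrite euclxx mulr_ge0// exprn_ge0.
  move=> i x x' u Kx Kx'; have [y Ky yk] := IH x x' u Kx Kx'.
  exists (S i y); first exact: KS.
  rewrite edistS exprS -mulrA.
  by apply: ler_pM; [exact: ltW (r_gt0 i)|exact: eucl_ge0|exact: rq|exact: yk].
have diff k p p' t : K p -> K p' ->
    edist (approx k.+1 p p' t) (approx k p p' t) <= 3 * D * q ^+ k.
  elim: k p p' t => [|k IH] p p' t Kp Kp'.
    (* Level 1 is within [q * D] of [K], level 0 within [D], and points of [K] are at most [D]
       apart: together at most [3 * D]. *)
    have [y Ky y1] := near 1%N p p' t Kp Kp'.
    have [z Kz z1] := near 0%N p p' t Kp Kp'.
    have yz : edist y z <= D by apply: le_trans (eucl_le_norm _ _) (KD _ _ Ky Kz).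
    have h1 := eucl_triangle y (approx 1 p p' t) (approx 0 p p' t).
    have h2 := eucl_triangle z y (approx 0 p p' t).
    rewrite (euclC z) in h2; rewrite expr1 in y1; rewrite expr0 in z1.
    have : q * D <= 1 * D by rewrite ler_wpM2r// ltW.
    by rewrite expr0; lra.
  apply: (glue_ind2 (P := fun y z => edist y z <= 3 * D * q ^+ k.+1)
    (@approx_pathlike k.+1) (@approx_pathlike k) (chainP Kp Kp')).
    by rewrite euclxx !mulr_ge0// exprn_ge0.
  move=> i x x' u Kx Kx'; rewrite edistS exprS mulrCA.
  by apply: ler_pM; [exact: ltW (r_gt0 i)|exact: eucl_ge0|exact: rq|exact: IH].
move=> Ka Kb.
have complE : forall F : set_system E, ProperFilter F -> cauchy F -> cvg F.
  by move=> F FF; exact: cauchy_cvg.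
have [|||g [cg gP]] := @geometric_limit R E complE (3 * D) q
    (fun k => approx k a b) _ q0 q1 _ _.
- by rewrite mulr_ge0.
- by move=> k t; apply: le_trans (norm_le_eucl _ _) (diff _ _ _ _ Ka Kb).
- by move=> k; have [] := approx_pathlike k Ka Kb.
have gval t z : (forall k, approx k a b t = z) -> g t = z.
  move=> h; apply: (norm_cvg_unique (gP t)).
  by rewrite /= (funext h); exact: cvg_cst.
exists g; split=> //.
- by apply: gval => k; have [] := approx_pathlike k Ka Kb.
- by apply: gval => k; have [] := approx_pathlike k Ka Kb.
move=> t; apply: contrapT => nKg.
have cK : closed K by apply: compact_closed compK; exact: norm_hausdorff.
have /nbhs_normP[e /= e0 he] : nbhs (g t) (~` K)
  by apply: open_nbhs_nbhs; split; rewrite ?openC.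
have e2 : 0 < e / 2 by rewrite divr_gt0.
have /cvgrPdist_lt/(_ _ e2) h1 := gP t.
have h2 : \forall k \near \oo, q ^+ k * D < e / 2.
  have : q ^+ k * D @[k --> \oo] --> 0 * D.
    by apply: cvgMl; apply: cvg_expr; rewrite ger0_norm.
  rewrite mul0r => /cvgrPdist_lt/(_ _ e2); apply: filterS => k /=.
  by rewrite sub0r normrN; apply: le_lt_trans; exact: ler_norm.
have [k [k1 k2]] := filter_ex (filterI h1 h2).
have [y Ky yk] := near k a b t Ka Kb.
apply: (he y _ Ky) => /=.
have := ler_normD (g t - approx k a b t) (approx k a b t - y).
rewrite subrKA; have := norm_le_eucl (approx k a b t) y.
lra.
Qed.

End Pieces.

(** * Arcs *)

Section MonotonePath.
Variables (R : realType) (n : nat).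
Notation E := 'rV[R]_n.
Implicit Types (g h : R -> E).

(** A preorder on paths, closed under pointwise limits in [g], that transfers the modulus of
    continuity of [h] to [g]. Freezing a path [h] along a loop gives a path tame with respect to
    [h]. *)
Definition tame g h := forall u v M, u <= v ->
  (forall s t, u <= s <= v -> u <= t <= v -> `|h s - h t| <= M) ->
  `|g u - g v| <= M.

Lemma tame_refl g : tame g g.
Proof. by move=> u v M uv; apply; rewrite !lexx uv. Qed.

Lemma tame_trans h g k : tame g h -> tame h k -> tame g k.
Proof.
move=> gh hk u v M uv kM; apply: gh uv _ => s t.
wlog st : s t / s <= t.
  move=> W; case: (leP s t) => [|/ltW] st; first exact: W.
  by move=> us ut; rewrite distrC; exact: W.
move=> /andP[us sv] /andP[ut tv]; apply: hk st _ => s' t' /andP[? ?] /andP[? ?].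
by apply: kM; apply/andP; split; lra.
Qed.

Lemma tame_continuous g h : tame g h -> continuous h -> continuous g.
Proof.
move=> gh ch t; apply/cvgrPdist_le => e e0.
have e2 : 0 < e / 2 by rewrite divr_gt0.
have /cvgrPdist_lt/(_ _ e2) := ch t.
move=> /nbhs_ballP[d /= d0 hd]; apply/nbhs_ballP; exists d => //= s ts0.
have {ts0}ts : `|t - s| < d by exact: ts0.
have bd u v : `|t - u| < d -> `|t - v| < d -> `|h u - h v| <= e.
  move=> tu tv.
  have h1 : `|h t - h u| < e / 2 by exact: hd.
  have h2 : `|h t - h v| < e / 2 by exact: hd.
  have := ler_normD (h u - h t) (h t - h v); rewrite subrKA (distrC (h u) (h t)).
  lra.
move: ts; rewrite ltr_norml => /andP[ts1 ts2].
case: (leP s t) => st; last rewrite distrC.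
  rewrite distrC; apply: (gh _ _ _ st) => u v /andP[? ?] /andP[? ?].
  by apply: bd; rewrite ltr_norml; lra.
rewrite distrC; apply: (gh _ _ _ (ltW st)) => u v /andP[? ?] /andP[? ?].
by apply: bd; rewrite ltr_norml; lra.
Qed.

Lemma ultra_compact_lim (T : Type) (G : set_system T) (f : T -> E) (I0 : set E) :
  UltraFilter G -> compact I0 -> (forall b, I0 (f b)) ->
  exists p, I0 p /\ f b @[b --> G] --> p.
Proof.
move=> UG cI I0f; have PG : ProperFilter G by exact: ultra_proper.
have [p [Ip clp]] : I0 `&` cluster (f b @[b --> G]) !=set0.
  apply: cI; change (G (f @^-1` I0)); apply: filterE => b; exact: I0f.
exists p; split=> // V nV.
have [//|GnV] := in_ultra_setVsetC (f @^-1` V) UG.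
have [y [? ?]] : (~` V) `&` V !=set0 by apply: clp.
by [].
Qed.

Lemma monotone_path (I0 : set E) g0 :
  compact I0 -> continuous g0 -> (forall t, I0 (g0 t)) ->
  exists g, [/\ continuous g, g 0 = g0 0, g 1 = g0 1, forall t, I0 (g t) &
    forall s u t, 0 <= s <= u -> u <= t <= 1 -> g s = g t -> g u = g s].
Proof.
move=> cI cg0 I0g0.
pose Q g := [/\ tame g g0, g 0 = g0 0, g 1 = g0 1 & forall t, I0 (g t)].
pose T := {g | Q g}.
have Qg0 : Q g0 by split=> //; exact: tame_refl.
pose Rl (a b : T) := `[< tame (sval b) (sval a) >].
have [||A totA|[g [tg g00 g01 Ig]] gmax] :=
    @ZL_preorder T (exist _ g0 Qg0) Rl.
- by move=> a; apply/asboolP; exact: tame_refl.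
- move=> b a c /asboolP ab /asboolP bc; apply/asboolP; exact: tame_trans bc ab.
- have [[a0 Aa0]|nA] := pselect (A !=set0); last first.
    by exists (exist _ g0 Qg0) => s As; case: nA; exists s.
  (* The upper bound of the chain [A] is a pointwise limit along an ultrafilter that contains the
     tails of [A]. *)
  pose F := filter_from A (fun a : T => [set b : T | Rl a b]).
  have FF : ProperFilter F.
    apply: filter_from_proper.
      apply: filter_from_filter; first by exists a0.
      have tr (a b c : T) : Rl a b -> Rl b c -> Rl a c.
        by move=> /asboolP ab /asboolP bc; apply/asboolP; exact: tame_trans bc ab.
      move=> a b Aa Ab; have [ab|ba] := totA _ _ Aa Ab.
        by exists b => // c /= bc; split=> //; exact: tr bc.
      by exists a => // c /= ac; split=> //; exact: tr ac.
    by move=> a Aa; exists a; apply/asboolP; exact: tame_refl.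
  have [G [UG FG]] := ultraFilterLemma FF.
  have PG : ProperFilter G by exact: ultra_proper.
  have lim t : exists p, I0 p /\ sval b t @[b --> G] --> p.
    by apply: ultra_compact_lim => // -[b [? ? ? h]]; exact: h.
  have [g gP] := choice lim.
  have tg a : (\forall b \near G, tame (sval b) a) -> tame g a.
    move=> nb u v M uv aM.
    have : sval b u - sval b v @[b --> G] --> g u - g v.
      by apply: cvgB; [exact: (gP u).2|exact: (gP v).2].
    move=> /cvg_norm; apply: (@closed_cvg _ _ _ _ _ [set x | x <= M]).
      exact: closed_le.
    by apply: filterS nb => b; exact.
  have ge t p : (forall b : T, sval b t = p) -> g t = p.
    move=> h; apply: (norm_cvg_unique (gP t).2).
    by rewrite /= (funext h); exact: cvg_cst.
  have Qg : Q g.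
    split.
    - by apply: tg; apply: filterE => -[b []].
    - by apply: ge => -[b []].
    - by apply: ge => -[b []].
    - by move=> t; exact: (gP t).1.
  exists (exist _ g Qg) => a Aa; apply/asboolP; apply: tg.
  by apply: FG; exists a => // b /asboolP.
exists g; split=> //; first exact: tame_continuous tg cg0.
move=> s u t /andP[s0 su] /andP[ut t1] gst.
pose g' w := if s <= w <= t then g s else g w.
have g'g : tame g' g.
  move=> a b M ab gM; rewrite /g'.
  have gab c d : a <= c <= b -> a <= d <= b -> `|g c - g d| <= M by exact: gM.
  case: ifPn => [/andP[sa at_]|na]; case: ifPn => [/andP[sb bt]|nb].
  - by rewrite subrr normr0 (le_trans _ (gM a a _ _)) ?subrr ?normr0// lexx ab.
  - rewrite gst; apply: gab; first by move: nb; rewrite negb_and -!ltNge; lra.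
    by rewrite lexx ab.
  - apply: gab; first by rewrite lexx ab.
    by move: na; rewrite negb_and -!ltNge; lra.
  - by apply: gab; rewrite lexx ab.
have Qg' : Q g'.
  split.
  - exact: tame_trans g'g tg.
  - rewrite /g'; case: ifPn => // /andP[? ?].
    by have -> : s = 0 by lra.
  - rewrite /g'; case: ifPn => // /andP[? ?].
    by rewrite gst; have -> : t = 1 by lra.
  - by move=> w; rewrite /g'; case: ifPn.
have /asboolP/= gg' := gmax (exist _ g' Qg') (asboolT g'g).
have : `|g s - g u| <= 0.
  apply: gg' su _ => v w /andP[? ?] /andP[? ?].
  by rewrite /g' !ifT ?subrr ?normr0//; lra.
by rewrite normr_le0 subr_eq0 => /eqP ->.
Qed.

End MonotonePath.

(** * Running maxima and injective reparametrisation *)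

Section RunningMax.
Variables (R : realType) (f : R -> R) (B : R).
Hypothesis fB : forall s, f s <= B.

Definition rmax t := sup (f @` [set s | s <= t]).

Let has_sup_f t : has_sup (f @` [set s | s <= t]).
Proof.
split; first by exists (f t), t => //=.
by exists B => _ [s _ <-]; exact: fB.
Qed.

Lemma rmax_ge s t : s <= t -> f s <= rmax t.
Proof. by move=> st; apply: sup_upper_bound; [exact: has_sup_f|exists s]. Qed.

Lemma rmax_le t M : (forall s, s <= t -> f s <= M) -> rmax t <= M.
Proof.
move=> fM; apply: ge_sup; first by have [] := has_sup_f t.
by move=> _ [s /= st <-]; exact: fM.
Qed.

Lemma rmax_homo s t : s <= t -> rmax s <= rmax t.
Proof. by move=> st; apply: rmax_le => u us; apply: rmax_ge; lra. Qed.

Lemma rmax_continuous : continuous f -> continuous rmax.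
Proof.
move=> cf t; apply/cvgrPdist_le => e e0.
have e2 : 0 < e / 2 by rewrite divr_gt0.
have /cvgrPdist_lt/(_ _ e2) := cf t.
move=> /nbhs_ballP[d /= d0 hd]; apply/nbhs_ballP; exists d => //= s ts0.
have {ts0}ts : `|t - s| < d by exact: ts0.
have fd u : `|t - u| < d -> f t - e / 2 < f u < f t + e / 2.
  by move=> tu; have /= := hd u tu; rewrite ltr_norml; lra.
have key a b : `|t - a| < d -> `|t - b| < d -> rmax b <= rmax a + e.
  rewrite !ltr_norml => ta tb; apply: rmax_le => u ub.
  case: (leP u a) => ua; first by have := rmax_ge ua; lra.
  have := rmax_ge (lexx a).
  have : f t - e / 2 < f a < f t + e / 2 by apply: fd; rewrite ltr_norml.
  have : f t - e / 2 < f u < f t + e / 2 by apply: fd; rewrite ltr_norml; lra.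
  lra.
have t0 : `|t - t| < d by rewrite subrr normr0.
by have := key _ _ ts t0; have := key _ _ t0 ts; rewrite ler_norml; lra.
Qed.

End RunningMax.

Section Reparametrisation.
Variables (R : realType) (n : nat).
Notation E := 'rV[R]_n.

Lemma clamp_homo (s t : R) : s <= t -> clamp s <= clamp t.
Proof.
move=> st; have := clamp_bound s; have := clamp_bound t.
case: (leP s 0) => [/clamp_le0 ->|s0]; first lra.
case: (leP 1 t) => [/clamp_ge1 ->|t1]; first lra.
by rewrite !clamp_id; lra.
Qed.

(* [h] only increases where [g] moves: it is a weighted sum, over rational
   starting times [p], of the furthest distance from [g p] reached since [p]. *)
Lemma progress (g : R -> E) (D : R) :
  continuous g -> (forall s t, `|g s - g t| <= D) ->
  (forall s u t, s <= u <= t -> g s = g t -> g u = g s) ->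
  exists h : R -> R, continuous h /\
    forall s t, s <= t -> (g s = g t -> h s = h t) /\ (g s <> g t -> h s < h t).
Proof.
move=> cg gD fib.
have D0 : 0 <= D := le_trans (normr_ge0 _) (gD 0 0).
pose mx (p s : R) := (p + s + `|s - p|) / 2.
have mxl p s : s <= p -> mx p s = p.
  by move=> sp; rewrite /mx ler0_norm; lra.
have mxr p s : p <= s -> mx p s = s.
  by move=> sp; rewrite /mx ger0_norm; lra.
have cmx p : continuous (mx p).
  move=> s; apply: cvgMl; apply: cvgD.
    by apply: cvgD; [exact: cvg_cst|exact: cvg_id].
  by apply: cvg_norm; apply: cvgB; [exact: cvg_id|exact: cvg_cst].
pose f p s := `|g (mx p s) - g p|.
have cf p : continuous (f p).
  move=> s; apply: cvg_norm; apply: cvgB; last exact: cvg_cst.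
  exact: (cont_comp (cmx p) cg).
have fl p s : s <= p -> f p s = 0 by move=> sp; rewrite /f mxl// subrr normr0.
have fr p s : p <= s -> f p s = `|g s - g p| by move=> sp; rewrite /f mxr.
have fD p s : f p s <= D by exact: gD.
pose chi p t := rmax (f p) t.
have chi0 p t : 0 <= chi p t.
  exact: le_trans (normr_ge0 _) (rmax_ge (fD p) (lexx t)).
have chiD p t : chi p t <= D by apply: (rmax_le (fD p)) => s _; exact: fD.
(* [q] runs through all rationals; an index that encodes none defaults to 0. *)
pose q k : R := ratr (odflt 0%Q (unpickle k)).
pose F k t : R^o := \sum_(j < k) (2^-1) ^+ j * chi (q j) t.
have w0 j : 0 <= (2^-1 : R) ^+ j by rewrite exprn_ge0.
have complR : forall G : set_system R^o, ProperFilter G -> cauchy G -> cvg G.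
  by move=> G GG; exact: cauchy_cvg.
have [||||h [ch hP]] := @geometric_limit R R^o complR D 2^-1 F D0.
- by rewrite invr_ge0.
- by rewrite invf_lt1// ltr1n.
- move=> k t; rewrite /F big_ord_recr/= addrAC subrr add0r normrM.
  by rewrite !ger0_norm// mulrC ler_wpM2r.
- elim=> [|k IH].
    by move=> t; rewrite /F; under eq_fun do rewrite big_ord0; exact: cvg_cst.
  move=> t; rewrite /F; under eq_fun do rewrite big_ord_recr/=.
  apply: cvgD; first exact: IH.
  by apply: cvgMr; exact: (rmax_continuous (fD _) (cf _)).
exists h; split=> // s t st; split=> [gst|gst].
  suff Fst k : F k s = F k t.
    by apply: (norm_cvg_unique (hP s)); rewrite /= (funext Fst); exact: hP.
  apply: eq_bigr => j _; congr (_ * _); set p := q j.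
  apply/eqP; rewrite eq_le; apply/andP; split; first exact: (rmax_homo (fD p) st).
  apply: (rmax_le (fD p)) => u ut.
  case: (leP u s) => us; first exact: (rmax_ge (fD p) us).
  case: (leP u p) => up; first by rewrite fl// chi0.
  have gu : g u = g s by apply: (fib _ _ t) => //; lra.
  case: (leP p s) => ps.
    by rewrite fr ?(ltW up)// gu -fr// (rmax_ge (fD p) (lexx s)).
  have gp : g p = g s by apply: (fib _ _ t) => //; lra.
  by rewrite fr ?(ltW up)// gu gp subrr normr0 chi0.
have lt_st : s < t.
  by rewrite lt_def st andbT; apply/eqP => ts; apply: gst; rewrite ts.
have gst0 : 0 < `|g s - g t|.
  by rewrite normr_gt0 subr_eq0; apply/eqP.
(* For a rational [p] just after [s], the point [g p] is closer to [g s] than [g t] is, so it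
   differs from [g t]. The term of [p] is then 0 at [s] and positive at [t]. *)
have /cvgrPdist_lt/(_ _ gst0)/nbhs_ballP[d /= d0 hd] := cg s.
have smin : s < Num.min (s + d) t by rewrite lt_min lt_st andbT; lra.
have [c] := rat_in_itvoo smin.
rewrite in_itv/= lt_min => /andP[sc /andP[cd ct]].
pose p : R := ratr c; pose k := pickle c.
have qk : q k = p by rewrite /q /k pickleK.
have gp : g p != g t.
  apply/eqP => gpt; have /hd /= : ball s d p.
    by rewrite /ball/= ltr_norml /p; lra.
  by rewrite gpt ltxx.
have chis : chi p s = 0.
  apply/eqP; rewrite eq_le chi0 andbT; apply: (rmax_le (fD p)) => u us.
  by rewrite fl// /p; lra.
have chit : 0 < chi p t.
  apply: (lt_le_trans _ (rmax_ge (fD p) (lexx t))).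
  by rewrite fr ?normr_gt0 ?subr_eq0 1?eq_sym// ltW.
have wk : 0 < (2^-1 : R) ^+ k * chi p t by rewrite mulr_gt0// exprn_gt0.
suff : (2^-1 : R) ^+ k * chi p t <= h t - h s by lra.
have : F j t - F j s @[j --> \oo] --> h t - h s.
  by apply: cvgB; exact: hP.
apply: (@closed_cvg _ _ _ _ _ [set x : R^o | _ <= x]); first exact: closed_ge.
exists k.+1 => // j /= kj; rewrite /F -sumrB (bigD1 (Ordinal kj))//= qk chis mulr0 subr0.
rewrite lerDl sumr_ge0// => i _; rewrite -mulrBr mulr_ge0// subr_ge0.
exact: (rmax_homo (fD _) st).
Qed.

Definition is_arc (a : R -> E) := continuous a /\
  forall s t, 0 <= s <= 1 -> 0 <= t <= 1 -> a s = a t -> s = t.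

Lemma arc_of_path (I0 : set E) (g0 : R -> E) : compact I0 -> continuous g0 ->
  (forall t, I0 (g0 t)) -> g0 0 <> g0 1 ->
  exists a, [/\ is_arc a, a 0 = g0 0, a 1 = g0 1 & forall t, I0 (a t)].
Proof.
move=> cI cg0 Ig0 g01.
have [g1 [cg1 g10 g11 Ig1 fib1]] := monotone_path cI cg0 Ig0.
pose g t := g1 (clamp t).
have cg : continuous g by exact: (cont_comp (@clamp_continuous R) cg1).
have g_0 : g 0 = g0 0 by rewrite /g clamp_le0.
have g_1 : g 1 = g0 1 by rewrite /g clamp_ge1.
have Ig t : I0 (g t) by exact: Ig1.
have fib s u t : s <= u <= t -> g s = g t -> g u = g s.
  move=> /andP[su ut]; apply: fib1.
    by rewrite clamp_homo//; have /andP[->] := clamp_bound s.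
  by rewrite clamp_homo//; have /andP[_ ->] := clamp_bound t.
have [M [_ hM]] := compact_bounded cI.
have {}hM x : I0 x -> `|x| <= `|M| + 1.
  move=> Ix; apply: (hM (`|M| + 1)) => //.
  by apply: le_lt_trans (ler_norm _) _; rewrite ltrDl.
have gD s t : `|g s - g t| <= 2 * (`|M| + 1).
  apply: le_trans (ler_normB _ _) _.
  by have := hM _ (Ig s); have := hM _ (Ig t); lra.
have [h [ch hP]] := progress cg gD fib.
have heq s t : h s = h t -> g s = g t.
  wlog st : s t / s <= t.
    move=> W; case: (leP s t) => [|/ltW] st; first exact: W.
    by move=> /esym hst; apply/esym; exact: W.
  move=> hst; apply: contrapT => gst; have := (hP _ _ st).2 gst.
  by rewrite hst ltxx.
have geq s t : g s = g t -> h s = h t.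
  case: (leP s t) => [|/ltW] st; first exact: (hP _ _ st).1.
  by move=> /esym /((hP _ _ st).1) ->.
have h01 : h 0 < h 1 by apply: (hP _ _ _).2 => //; rewrite g_0 g_1.
pose sig s := h 0 + clamp s * (h 1 - h 0).
have csig : continuous sig.
  exact: (@cont_comp R R R _ _ (@clamp_continuous R) (@affine_continuous R (h 0) _)).
have /choice[tau tauP] s : exists t, 0 <= t <= 1 /\ h t = sig s.
  have [||t] := @IVT R h 0 1 (sig s) ler01.
  - exact: (continuous_subspaceT ch).
  - rewrite (min_idPl (ltW h01)) (max_idPr (ltW h01)) /sig.
    by have := clamp_bound s; nra.
  - by rewrite in_itv/=; exists t.
exists (g \o tau); split=> /=.
- split=> /= [s|s t s01 t01].
    apply/cvgrPdist_lt => e e0.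
    (* [T] collects the times at which [g] is at least [e] away from [g (tau s)]. Its image under
       [h] is compact and misses [sig s], hence also [sig t] for [t] close to [s]. *)
    pose T := `[0, 1]%classic `&` [set t | e <= `|g (tau s) - g t|].
    have cT : compact T.
      apply: compact_closedI; first exact: segment_compact.
      apply: (@preimage_closed _ _ (fun t => `|g (tau s) - g t|) [set x | e <= x]).
        by move=> t _; apply: cvg_norm; apply: cvgB; [exact: cvg_cst|exact: cg].
      exact: closed_ge.
    have cHT : closed (h @` T).
      apply: compact_closed; first exact: (@norm_hausdorff R R^o).
      by apply: continuous_compact cT; exact: (continuous_subspaceT ch).
    have nT : (~` (h @` T)) (sig s).
      move=> [t [_ /= et]]; rewrite -(tauP s).2 => /heq gt.
      by move: et; rewrite gt subrr normr0 leNgt e0.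
    have nb : nbhs (sig s) (~` (h @` T)) by apply: open_nbhs_nbhs; split; rewrite ?openC.
    have hs : \forall t \near s, (~` (h @` T)) (sig t) by exact: (csig s _ nb).
    apply: (@filterS _ _ (nbhs_filter s) _ _ _ hs) => t /= ht.
    rewrite ltNge; apply/negP => et.
    apply: ht; rewrite -(tauP t).2; exists (tau t) => //; split=> //=.
    by rewrite in_itv/=; exact: (tauP t).1.
  move=> /geq; rewrite (tauP s).2 (tauP t).2 /sig !clamp_id// => /addrI.
  by apply: mulIf; rewrite subr_eq0 gt_eqF.
- rewrite -g_0; apply: heq; rewrite (tauP 0).2 /sig clamp_le0//.
  by rewrite mul0r addr0.
- rewrite -g_1; apply: heq; rewrite (tauP 1).2 /sig clamp_ge1//.
  by rewrite mul1r addrC subrK.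
- by move=> t; exact: Ig.
Qed.

End Reparametrisation.

(** * Separation in dendrites *)

Section Theta.
Variables (R : realType) (n : nat) (K : set 'rV[R]_n).
Notation E := 'rV[R]_n.
Hypothesis noscc : ~ contains_simple_closed_curve K.

Lemma compact_max (A : set R) : A !=set0 -> compact A ->
  exists u, A u /\ forall t, A t -> t <= u.
Proof.
move=> A0 cA; have cid : {within A, continuous (id : R -> R)}.
  by apply: continuous_subspaceT => x; exact: cvg_id.
have [u /set_mem Au h] := compact_EVT_max A0 cA cid.
by exists u; split=> // t At; apply: h; exact: mem_set.
Qed.

Lemma compact_min (A : set R) : A !=set0 -> compact A ->
  exists u, A u /\ forall t, A t -> u <= t.
Proof.
move=> A0 cA; have cid : {within A, continuous (id : R -> R)}.
  by apply: continuous_subspaceT => x; exact: cvg_id.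
have [u /set_mem Au h] := compact_EVT_min A0 cA cid.
by exists u; split=> // t At; apply: h; exact: mem_set.
Qed.

Lemma path_image_compact (g : R -> E) (s t : R) : continuous g ->
  compact (g @` `[s, t]).
Proof.
move=> cg; apply: continuous_compact; last exact: segment_compact.
exact: continuous_subspaceT.
Qed.

Lemma joined_compact (G : set E) a b : joined G a b ->
  exists g : R -> E, [/\ continuous g, g 0 = a, g 1 = b, forall t, (g @` `[0, 1]) (g t) &
    g @` `[0, 1] `<=` G].
Proof.
move=> [g [cg ga gb Gg]]; exists (fun t => g (clamp t)); split.
- exact: (cont_comp (@clamp_continuous R) cg).
- by rewrite clamp_le0.
- by rewrite clamp_ge1.
- move=> t; exists (clamp t); first by rewrite /= in_itv/= clamp_bound.
  by rewrite (clamp_id (clamp_bound t)).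
- by move=> _ [t _ <-]; exact: Gg.
Qed.

Lemma arc_of_joined (G : set E) a b : a <> b -> joined G a b ->
  exists g : R -> E, [/\ is_arc g, g 0 = a, g 1 = b & forall t, G (g t)].
Proof.
move=> ab /joined_compact[g [cg ga gb Ig IG]].
have [|h [ah h0 h1 Ih]] := arc_of_path (@path_image_compact g 0 1 cg) cg Ig.
  by rewrite ga gb.
exists h; split=> //; [by rewrite h0|by rewrite h1|].
by move=> t; exact/IG/Ih.
Qed.

(* A second path avoiding [a t0] leaves the initial part of the arc for the
   last time and then first meets its final part: this detour closes up. *)
Lemma arc_separates (a : R -> E) (t0 : R) : is_arc a -> (forall t, K (a t)) ->
  0 < t0 < 1 -> ~ joined (K `\ a t0) (a 0) (a 1).
Proof.
move=> [ca ia] Ka /andP[t00 t01] J.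
have i0 : 0 <= (0 : R) <= 1 by lra.
have i1 : 0 <= (1 : R) <= 1 by lra.
have a01 : a 0 <> a 1 by move=> /(ia _ _ i0 i1) /eqP; rewrite eq_sym oner_eq0.
have [b [[cb ib] b0 b1 Kb]] := arc_of_joined a01 J.
have cl (s t : R) : closed (a @` `[s, t]).
  apply: compact_closed; first exact: norm_hausdorff.
  exact: path_image_compact.
have cpt (s t u v : R) : compact (`[u, v]%classic `&` (b @^-1` (a @` `[s, t]))).
  apply: compact_closedI; first exact: segment_compact.
  by apply: preimage_closed; [move=> x _; exact: cb|exact: cl].
have [|u [[/= u01 [s s0 asu]] umax]] := compact_max _ (cpt 0 t0 0 1).
  exists 0; split; first by rewrite /= in_itv/= lexx ler01.
  by exists 0; rewrite ?b0//= in_itv/= lexx ltW.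
have [|v [[/= uv [t t1 atv]] vmin]] := compact_min _ (cpt t0 1 u 1).
  exists 1; split; first by move: u01; rewrite /= !in_itv/= lexx andbT => /andP[].
  by exists 1; rewrite ?b1//= in_itv/= lexx ltW.
move: u01 s0 uv t1; rewrite !in_itv/= => /andP[u0 u1] /andP[s0 st0] /andP[uv v1].
move=> /andP[tt0 t1].
have st0' : s < t0.
  rewrite lt_neqAle st0 andbT; apply/eqP => e.
  by have [_] := Kb u; apply; rewrite /= -asu e.
have tt0' : t0 < t.
  rewrite lt_neqAle tt0 andbT; apply/eqP => e.
  by have [_] := Kb v; apply; rewrite /= -atv e.
have uv' : u < v.
  rewrite lt_neqAle uv andbT; apply/eqP => e.
  have : a s = a t by rewrite asu atv e.
  move=> /ia h; suff : s = t by lra.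
  by apply: h; lra.
have detour x y : u < x < v -> 0 <= y <= 1 -> b x <> a y.
  move=> /andP[ux xv] /andP[y0 y1] bxy; case: (leP y t0) => yt.
    suff : x <= u by lra.
    apply: umax; split=> /=; first by rewrite in_itv/=; lra.
    by exists y => //=; rewrite in_itv/= y0.
  suff : v <= x by lra.
  apply: vmin; split=> /=; first by rewrite in_itv/=; lra.
  by exists y => //=; rewrite in_itv/= y1 ltW.
(* The closed curve follows [a] from [a s] to [a t] and returns along [b] from time [v] to time [u];
   by [detour] the two arcs meet only at their ends. *)
pose g x := a (s + x * (t - s)); pose h x := b (v + x * (u - v)).
have cg : continuous g by exact: (cont_comp (@affine_continuous R s (t - s)) ca).
have ch : continuous h by exact: (cont_comp (@affine_continuous R v (u - v)) cb).
have gh : g 1 = h 0 by rewrite /g /h mul1r mul0r addr0 addrC subrK.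
apply: noscc; exists (concat g h); split.
- by apply: continuous_subspaceT; exact: concat_continuous.
- rewrite concat0// concat1 /g /h mul0r addr0 mul1r.
  by rewrite (addrC v) subrK.
- have mixed x y : 0 <= x <= 1/2 -> 1/2 < y < 1 -> concat g h x <> concat g h y.
    move=> /andP[x0 x1] /andP[y0 y1].
    rewrite concatE1// concatE2 ?ltW// !clamp_id; [|lra|lra].
    by move=> /esym; apply: detour; apply/andP; split; nra.
  move=> x y; rewrite !in_itv/= => /andP[x0 x1] /andP[y0 y1].
  case: (leP x (1/2)) => xh; case: (leP y (1/2)) => yh.
  + rewrite !concatE1// !clamp_id; [|lra|lra].
    move=> /ia h1; have : s + 2 * x * (t - s) = s + 2 * y * (t - s).
      by apply: h1; apply/andP; split; nra.
    move=> /addrI /mulIf; rewrite subr_eq0 => h2.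
    have : 2 * x = 2 * y by apply: h2; rewrite gt_eqF//; lra.
    lra.
  + by move=> e; case: (mixed x y) => //; apply/andP.
  + by move=> e; case: (mixed y x) => //; apply/andP.
  + rewrite !concatE2 ?ltW// !clamp_id; [|lra|lra].
    move=> /ib h1; have : v + (2 * x - 1) * (u - v) = v + (2 * y - 1) * (u - v).
      by apply: h1; apply/andP; split; nra.
    move=> /addrI /mulIf; rewrite subr_eq0 => h2.
    have : 2 * x - 1 = 2 * y - 1 by apply: h2; rewrite lt_eqF//; lra.
    lra.
- move=> _ [x _ <-]; case: (leP x (1/2)) => xh.
    by rewrite concatE1//; exact: Ka.
  by rewrite concatE2 ?ltW//; exact: (Kb _).1.
Qed.

End Theta.

(** * Local path-connectedness of the attractor *)

Section LocalStructure.
Variables (R : realType) (n m : nat) (r : 'I_m -> R).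
Variables (S : 'I_m -> 'rV[R]_n -> 'rV[R]_n) (K : set 'rV[R]_n).
Notation E := 'rV[R]_n.
Hypothesis simS : forall i, similarity (r i) (S i) /\ r i < 1.
Hypothesis attrK : attractor S K.
Hypothesis conK : connected K.
Implicit Types (a b c x y z : E) (w : seq 'I_m).

Let compK : compact K. Proof. by have [] := attrK. Qed.

Let KS i x : K x -> K (S i x).
Proof. by move=> Kx; have [_ _ ->] := attrK; exists i => //; exists x. Qed.

Let KE y : K y -> exists i x, K x /\ y = S i x.
Proof.
by have [_ _ {1}->] := attrK => -[i _ [x Kx <-]]; exists i, x.
Qed.

Definition word_ratio w : R := \prod_(i <- w) r i.

Lemma word_similarity w : similarity (word_ratio w) (word_map S w).
Proof.
rewrite /word_ratio; elim: w => [|i w [w0 IH]].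
  by rewrite big_nil; split=> // x y; rewrite mul1r.
have [[i0 Si] _] := simS i.
by rewrite big_cons; split=> [|x y]; rewrite ?mulr_gt0//= Si IH mulrA.
Qed.

Lemma word_map_rcons w i x : word_map S (rcons w i) x = word_map S w (S i x).
Proof. by elim: w => //= j w ->. Qed.

Lemma word_map_K w x : K x -> K (word_map S w x).
Proof. by move=> Kx; elim: w => //= i w; exact: KS. Qed.

Lemma word_map_continuous w : continuous (word_map S w).
Proof. exact: similarity_continuous (word_similarity w). Qed.

Lemma closed_word_piece w : closed (word_map S w @` K).
Proof.
apply: compact_closed; first exact: norm_hausdorff.
apply: continuous_compact compK.
by apply: continuous_subspaceT; exact: word_map_continuous.
Qed.

Lemma words_cover k y : K y ->
  exists w, size w = k /\ (word_map S w @` K) y.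
Proof.
elim: k y => [|k IH] y Ky; first by exists [::]; split=> //; exists y.
have [i [x [Kx ->]]] := KE Ky; have [w [sw [z Kz <-]]] := IH x Kx.
by exists (i :: w); rewrite /= sw; split=> //; exists z.
Qed.

Lemma small_words e : 0 < e -> exists k, forall w a b, size w = k ->
  (word_map S w @` K) a -> (word_map S w @` K) b -> edist a b < e.
Proof.
move=> e0; have [q [q0 q1 rq]] := ratio_bound simS.
have [D [D0 KD]] := compact_edist_bound compK.
have : q ^+ k * D @[k --> \oo] --> 0 * D.
  by apply: cvgMl; apply: cvg_expr; rewrite ger0_norm.
rewrite mul0r => /cvgrPdist_lt/(_ _ e0)[k _ /(_ k (leqnn _))] /=.
rewrite sub0r normrN => hk; exists k => w _ _ sw [a Ka <-] [b Kb <-].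
have [w0 ->] := word_similarity w.
apply: le_lt_trans (le_lt_trans (ler_norm _) hk).
apply: ler_pM; [exact: ltW|exact: eucl_ge0| |].
  rewrite -sw /word_ratio; elim: (w) => [|i v IH]; first by rewrite big_nil.
  rewrite big_cons exprS; apply: ler_pM => //.
    by have [[/ltW]] := simS i.
  by rewrite prodr_ge0// => j _; have [[/ltW]] := simS j.
exact: le_trans (eucl_le_norm _ _) (KD _ _ Ka Kb).
Qed.

(** The finitely many pieces of level [k] that miss [a] form a closed set, so a point of [K] close
    to [a] shares a piece with [a]. That piece is an image of [K], hence path-connected, and it lies
    in [V] for suitable [k]. *)
Lemma local_joined a (V : set E) : K a -> nbhs a V ->
  \forall b \near a, K b -> joined (K `&` V) a b.
Proof.
move=> Ka /nbhs_ballP[e /= e0 eV]; have [k hk] := small_words e0.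
pose B := \bigcup_(w in [set w | size w = k /\ ~ (word_map S w @` K) a])
  (word_map S w @` K).
have cB : closed B.
  apply: closed_bigcup; last by move=> w _; exact: closed_word_piece.
  apply: (@sub_finite_set _ _ (range (@tval k 'I_m))).
    move=> w [/= sw _]; exists (tcast sw (in_tuple w)) => //.
    by rewrite val_tcast.
  by apply: finite_image; exact: finite_finset.
have : nbhs a (~` B).
  apply: open_nbhs_nbhs; split; first by rewrite openC.
  by move=> [w [_ /= h] ?]; apply: h.
apply: (@filterS _ _ (nbhs_filter a)) => b nBb Kb.
have [w [sw Kwb]] := words_cover k Kb.
have Kwa : (word_map S w @` K) a.
  by apply: contrapT => nKwa; apply: nBb; exists w.
have [a' Ka' aE] := Kwa; have [b' Kb' bE] := Kwb.
have := joined_image (@word_map_continuous w) (K_joined simS attrK conK Ka' Kb').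
rewrite aE bE; apply: joined_sub => y Kwy; split.
  by have [y' Ky' <-] := Kwy; exact: word_map_K.
apply: eV; rewrite -ball_normE/=.
by apply: le_lt_trans (norm_le_eucl _ _) _; exact: (hk w).
Qed.

Lemma local_joined_avoid a z : K a -> a <> z ->
  \forall b \near a, K b -> joined (K `\ z) a b.
Proof.
move=> Ka az; apply: local_joined => //; apply: open_nbhs_nbhs; split=> //.
rewrite openC; apply: compact_closed; first exact: norm_hausdorff.
exact: compact_set1.
Qed.

End LocalStructure.

(** * Cut points and neighbourhoods with finite boundary *)

Section CutPoints.
Variables (R : realType) (n m : nat) (r : 'I_m -> R).
Variables (S : 'I_m -> 'rV[R]_n -> 'rV[R]_n) (K : set 'rV[R]_n).
Notation E := 'rV[R]_n.
Hypothesis simS : forall i, similarity (r i) (S i) /\ r i < 1.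
Hypothesis attrK : attractor S K.
Hypothesis conK : connected K.
Hypothesis noscc : ~ contains_simple_closed_curve K.
Implicit Types (a b c x y z : E).

Let compK : compact K. Proof. by have [] := attrK. Qed.

Let compact_outside (V : set E) : compact (K `&` ~` V°).
Proof.
apply: compact_closedI => //; rewrite closedC; exact: open_interior.
Qed.

(** [z] is a point at a small positive time on an arc from [x] to [c]. By compactness one time
    serves all points outside the interior of [V]: those joined to [c] off [x] are joined to [c] off
    [z]. If one of them were also joined to [x] off [z], the ends of the arc would be joined off
    [z], against [arc_separates]. *)
Lemma cut_near x c (V : set E) : K x -> K c -> x <> c -> nbhs x V ->
  exists z, joined (K `\ x) c z /\
    forall b, joined (K `\ x) c b -> joined (K `\ z) x b -> V b.
Proof.
move=> Kx Kc xc nV.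
have [g [ag g0 g1 Kg]] := arc_of_joined xc (K_joined simS attrK conK Kx Kc).
have [cg ig] := ag.
have g_at0 : g t @[t --> 0^'+] --> x.
  by rewrite -g0; apply: cvg_at_right_filter; exact: cg.
have cov : \forall t \near 0^'+, K `&` ~` V° `<=`
    (fun b => joined (K `\ x) c b -> joined (K `\ g t) c b).
  apply: ((compact_near_coveringP _).1 (@compact_outside V)) => b [Kb nVb].
  have bx : b <> x by move=> bx; apply: nVb; rewrite bx.
  have [cb|ncb] := pselect (joined (K `\ x) c b); last first.
    have nb := local_joined_avoid simS attrK conK Kb bx.
    near=> b' t => cb'; exfalso; apply: ncb; apply: (joined_trans cb').
    apply: joined_sym; have : K b' -> joined (K `\ x) b b' by near: b'.
    by apply; have [_ []] := joined_mem cb'.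
  (* For small [t] the point [g t] is off the path from [c] to [b], and it lies in a ball about [x]
     disjoint from the ball of the same radius about [b]. So it is avoided both up to [b] and from
     [b] to [b']. *)
  have [h [ch h0 h1 Ih IK]] := joined_compact cb.
  have nx : nbhs x (~` (h @` `[0, 1])).
    apply: open_nbhs_nbhs; split; last by move=> /IK[_]; apply.
    rewrite openC; apply: compact_closed; first exact: norm_hausdorff.
    exact: (@path_image_compact R n h 0 1 ch).
  have e0 : 0 < `|b - x| / 2.
    by rewrite divr_gt0// normr_gt0 subr_eq0; apply/eqP.
  have nb : \forall b' \near b, K b' ->
      joined (K `&` ball b (`|b - x| / 2)) b b'.
    by apply: (local_joined simS attrK conK Kb); exact: nbhsx_ballx.
  have nt1 : \forall t \near 0^'+, (~` (h @` `[0, 1])) (g t) by exact: (g_at0 _ nx).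
  have nt2 : \forall t \near 0^'+, ball x (`|b - x| / 2) (g t).
    exact: (g_at0 _ (nbhsx_ballx x _ e0)).
  near=> b' t => cb'.
  have ht : (~` (h @` `[0, 1])) (g t) by near: t.
  have bt : ball x (`|b - x| / 2) (g t) by near: t.
  have bb' : K b' -> joined (K `&` ball b (`|b - x| / 2)) b b' by near: b'.
  have Kb' : K b' by have [_ []] := joined_mem cb'.
  apply: (@joined_trans _ _ _ b).
    exists h; split=> // t'; split; first by have [] := IK _ (Ih t').
    by move=> /= e; apply: ht; rewrite -e; exact: Ih.
  apply: joined_sub (bb' Kb') => y [Ky]; rewrite -ball_normE/= => yb.
  split=> //= ey; move: bt; rewrite -ey -ball_normE/= => xy.
  have := ler_normD (b - y) (y - x); rewrite subrKA (distrC y x); lra.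
have t1 : \forall t \near (0:R)^'+, t < 1 by exact: nbhs_right_lt.
have t0 : \forall t \near (0:R)^'+, 0 < t by exact: nbhs_right_gt.
near (0:R)^'+ => t.
have t01 : 0 < t < 1 by apply/andP; split; near: t.
have ht : K `&` ~` V° `<=`
    (fun b => joined (K `\ x) c b -> joined (K `\ g t) c b) by near: t.
exists (g t); split.
  rewrite -g1; apply: joined_segment => // u.
  have /andP[tgt0 /ltW tle1] := t01.
  rewrite (min_idPr tle1) (max_idPl tle1) => /andP[tu u1]; split=> //=.
  by rewrite -g0 => /ig h; have : u = 0 by [apply: h; lra]; lra.
move=> b cb xb; apply: contrapT => nVb.
have sep := arc_separates noscc ag Kg t01; rewrite g0 g1 in sep.
apply: sep; apply: (joined_trans xb); apply: joined_sym; apply: ht => //.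
split; first by have [_ []] := joined_mem cb.
by move=> /interior_subset.
Unshelve. all: by end_near. Qed.

Lemma open_bigcap_finite (T : topologicalType) (I : choiceType) (A : set I)
    (F : I -> set T) : finite_set A -> (forall i, A i -> open (F i)) ->
  open (\bigcap_(i in A) F i).
Proof.
move=> fA oF; rewrite -closedC setC_bigcap; apply: closed_bigcup => // i Ai.
by rewrite closedC; exact: oF.
Qed.

Lemma small_boundary x (V : set E) : K x -> nbhs x V ->
  exists O : set E, [/\ open O, O x, K `&` O `<=` V,
    finite_set (boundary_in K (K `&` O)) &
    [/\ forall y, boundary_in K (K `&` O) y -> y <> x &
    forall y z, boundary_in K (K `&` O) y -> boundary_in K (K `&` O) z ->
      joined (K `\ x) y z -> y = z]].
Proof.
move=> Kx nV.
pose J y z := joined (K `\ x) y z.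
have JJ y z : J y z -> J z y by exact: joined_sym.
have Jt y z t : J y z -> J z t -> J y t by exact: joined_trans.
have Jr y : K y -> y <> x -> J y y by move=> Ky yx; apply: joined_refl.
pose B := K `&` ~` V°.
have Bx y : B y -> y <> x by move=> [_ nVy] yx; apply: nVy; rewrite yx.
have := @compact_outside V; rewrite compact_cover -/B.
move=> /(_ _ B (fun c => [set b | K b -> J c b]°)) [].
- by move=> c _; exact: open_interior.
- move=> b Bb; exists b => //=.
  have := local_joined_avoid simS attrK conK Bb.1 (Bx _ Bb).
  by move=> h; apply: (@filterS _ _ (nbhs_filter b) _ _ _ h).
move=> D DB; set Ds := (X in cover X _) => covD.
have DsB i : Ds i -> B i by move=> /DB /set_mem.
have fDs : finite_set Ds by exact: finite_fset.
(* [rep c] depends only on the component of [c], so indices in one component receive the same cut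
   point. *)
pose rep c : E := get [set y | J c y].
have repJ c : K c -> c <> x -> J c (rep c).
  by move=> Kc cx; rewrite /rep; case: xgetP => [y -> //|/(_ c)/(_ (Jr _ Kc cx))].
have rep_eq c c' : J c c' -> rep c = rep c'.
  move=> cc'; rewrite /rep; congr get; apply/seteqP; split=> y /= h.
    exact: Jt (JJ _ _ cc') h.
  exact: Jt cc' h.
have /choice[z zP] c : exists z, J c c -> J c z /\
    forall b, J c b -> joined (K `\ z) x b -> V b.
  have [cc|ncc] := pselect (J c c); last by exists c.
  have [[Kc /= cx] _] := joined_mem cc.
  have xc : x <> c by move/esym.
  by have [z hz] := cut_near Kx Kc xc nV; exists z.
pose A := rep @` Ds.
have AD c : A c -> exists i, J i c /\ rep i = c.
  move=> [i /DsB Bi <-]; exists i; split=> //.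
  by apply: repJ; [exact: Bi.1|exact: Bx].
have AJ c : A c -> J c c.
  by move=> /AD[i [ic _]]; exact: Jt (JJ _ _ ic) ic.
have fA : finite_set A by exact: finite_image.
have zx c : A c -> z c <> x.
  by move=> /AJ /zP[cz _]; have [_ [_ zx]] := joined_mem cz.
(* The condition restricts points of [K] only, so that the interior can be taken in the whole
   space. *)
pose O := \bigcap_(c in A) [set b | K b -> joined (K `\ z c) x b]°.
have oO : open O.
  by apply: open_bigcap_finite => // c _; exact: open_interior.
have KO b c : K b -> O b -> A c -> joined (K `\ z c) x b.
  by move=> Kb Ob Ac; have /interior_subset := Ob c Ac; exact.
have bdO : boundary_in K (K `&` O) `<=` z @` A.
  move=> y [[Ky clO] clnO]; apply: contrapT => nzy.
  have yz c : A c -> y <> z c by move=> Ac yz; apply: nzy; exists c.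
  have ny c : A c -> \forall b \near y, K b -> joined (K `\ z c) y b.
    by move=> Ac; apply: (local_joined_avoid simS attrK conK Ky); exact: yz.
  (* If no cut point separates [y] from [x], none separates the nearby points, so [y] is not
     adherent to the complement; if some cut point does, it also separates the nearby points, so [y]
     is not adherent to [O] within [K]. *)
  have [Oy|] := pselect (forall c, A c -> joined (K `\ z c) x y).
    have [b [[Kb nb] Ob]] : (K `\` (K `&` O)) `&` O !=set0.
      apply: clnO; apply: open_nbhs_nbhs; split=> // c Ac.
      apply: (@filterS _ _ (nbhs_filter y) _ _ _ (ny c Ac)) => b yb Kb.
      exact: joined_trans (Oy c Ac) (yb Kb).
    by apply: nb.
  move=> /existsNP[c /not_implyP[Ac nxy]]; apply: nxy.
  have [b [[Kb Ob] yb]] := clO _ (ny c Ac).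
  exact: joined_trans (KO _ _ Kb Ob Ac) (joined_sym (yb Kb)).
exists O; split=> //.
- move=> c Ac; have xz : x <> z c by move=> /esym; exact: zx.
  exact: (local_joined_avoid simS attrK conK Kx xz).
- move=> y [Ky Oy]; apply: contrapT => nVy.
  have By : B y by split=> // /interior_subset.
  have [i Di /interior_subset/= /(_ Ky) iy] := covD y By.
  have Bi := DsB _ Di.
  have Ai : A (rep i) by exists i.
  apply: nVy; have [_] := zP _ (AJ _ Ai); apply; last exact: KO.
  by apply: Jt iy; apply: JJ; apply: repJ; [exact: Bi.1|exact: Bx].
- by apply: sub_finite_set bdO _; exact: finite_image.
- split=> [y /bdO[c Ac <-]|_ _ /bdO[c Ac <-] /bdO[c' Ac' <-] zz]; first exact: zx.
  have [cz _] := zP _ (AJ _ Ac); have [cz' _] := zP _ (AJ _ Ac').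
  have [i [ic <-]] := AD _ Ac; have [i' [ic' <-]] := AD _ Ac'.
  congr z; apply: rep_eq; have zi' := Jt _ _ _ (JJ _ _ cz') (JJ _ _ ic').
  exact: Jt ic (Jt _ _ _ cz (Jt _ _ _ zz zi')).
Qed.

End CutPoints.

(** * Counting pieces *)

Section Diameter.
Variables (R : realType) (n : nat).
Notation E := 'rV[R]_n.
Implicit Types (A : set E).

Lemma diam_ge A (D : R) a b : (forall a b, A a -> A b -> edist a b <= D) ->
  A a -> A b -> edist a b <= diam A.
Proof.
move=> AD Aa Ab; apply: sup_upper_bound; last by exists (a, b).
split; first by exists (edist a b), (a, b).
by exists D => _ [[a' b'] [/= Aa' Ab'] <-]; exact: AD.
Qed.

Lemma diam_le A (D : R) : A !=set0 -> (forall a b, A a -> A b -> edist a b <= D) ->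
  diam A <= D.
Proof.
move=> [a Aa] AD; apply: ge_sup; first by exists (edist a a), (a, a).
by move=> _ [[a' b'] [/= Aa' Ab'] <-]; exact: AD.
Qed.

Lemma diam_image A (D s : R) (f : E -> E) : A !=set0 ->
  (forall a b, A a -> A b -> edist a b <= D) -> similarity s f ->
  diam (f @` A) = s * diam A.
Proof.
move=> [a0 Aa0] AD [s0 fs].
have fD a b : (f @` A) a -> (f @` A) b -> edist a b <= s * D.
  by move=> [a' Aa' <-] [b' Ab' <-]; rewrite fs ler_pM2l//; exact: AD.
apply/eqP; rewrite eq_le; apply/andP; split.
  apply: diam_le; first by exists (f a0), a0.
  move=> _ _ [a Aa <-] [b Ab <-]; rewrite fs ler_pM2l//; exact: (diam_ge AD).
rewrite -ler_pdivlMl//; apply: diam_le; first by exists a0.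
move=> a b Aa Ab; rewrite ler_pdivlMl// -fs.
by apply: (diam_ge fD); [exists a|exists b].
Qed.

Lemma edist_continuous (x : E) : continuous (fun y => edist x y).
Proof.
move=> y; apply/(@cvgrPdist_lt _ _ _ _ (nbhs_filter y)) => e e0.
have n1 : (0 : R) < n%:R + 1 by rewrite ltr_wpDl.
have : 0 < e / (n%:R + 1) by rewrite divr_gt0.
move=> /(nbhsx_ballx y); apply: (@filterS _ _ (nbhs_filter y)) => z /=.
rewrite -ball_normE/= ltr_pdivlMr// => yz.
rewrite (euclC x y) (euclC x z); apply: le_lt_trans (eucl_lip y z x) _.
by apply: le_lt_trans yz; rewrite mulrC ler_wpM2l// lerDl.
Qed.

End Diameter.

(** A countable set has Lebesgue measure zero and cannot contain an interval of positive length.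
    This supplies a radius that is not the diameter of a piece. *)
Lemma countable_avoid (R : realType) (A : set R) (e : R) :
  countable A -> 0 < e -> exists s, 0 < s < e /\ ~ A s.
Proof.
move=> cA e0; apply: contrapT => h.
have sub : `]0, e[%classic `<=` A.
  move=> s; rewrite /= in_itv/= => se; apply: contrapT => nAs.
  by apply: h; exists s.
have cI := sub_countable (subset_card_le sub) cA.
have := countable_lebesgue_measure0 cI; rewrite lebesgue_measure_itv/= lte_fin e0.
by rewrite sube0 => -[]; apply/eqP; rewrite gt_eqF.
Qed.

Section Counting.
Variables (R : realType) (n m : nat) (r : 'I_m -> R).
Variables (S : 'I_m -> 'rV[R]_n -> 'rV[R]_n) (K : set 'rV[R]_n).
Notation E := 'rV[R]_n.
Hypothesis simS : forall i, similarity (r i) (S i) /\ r i < 1.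
Hypothesis attrK : attractor S K.
Hypothesis conK : connected K.
Implicit Types (a b c x y z : E) (w : seq 'I_m).

Let compK : compact K. Proof. by have [] := attrK. Qed.

Let K0 : K !=set0. Proof. by have [] := attrK. Qed.

Let boundK : exists D, forall a b, K a -> K b -> edist a b <= D.
Proof.
have [D [_ KD]] := compact_edist_bound compK.
by exists D => a b Ka Kb; exact: le_trans (eucl_le_norm _ _) (KD _ _ Ka Kb).
Qed.

Let boundKw : exists D, forall w a b, (word_map S w @` K) a ->
  (word_map S w @` K) b -> edist a b <= D.
Proof.
have [D KD] := boundK; exists D => w _ _ [a Ka <-] [b Kb <-].
by apply: KD; exact: (word_map_K attrK).
Qed.

Lemma diam_word w : diam (word_map S w @` K) = word_ratio r w * diam K.
Proof.
by have [D KD] := boundK; exact: (diam_image K0 KD (word_similarity simS w)).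
Qed.

(* Take the first prefix of an address of [y] whose piece has diameter at most
   [d]. *)
Lemma piece_of_size y (d : R) : K y -> 0 < d < diam K ->
  exists w, [/\ w != [::], (word_map S w @` K) y &
    d * inf (range r) < diam (word_map S w @` K) <= d].
Proof.
move=> Ky /andP[d0 dK]; apply: contrapT => nw.
have big k : exists w, [/\ size w = k, (word_map S w @` K) y &
    d < diam (word_map S w @` K)].
  elim: k => [|k [w [sw [y' Ky' yE] dw]]].
    exists [::]; split=> //; first by exists y.
    by rewrite diam_word /word_ratio big_nil mul1r.
  have : K y' by [].
  have [_ _ {1}->] := attrK => -[i _ [y2 Ky2 y2E]].
  have Kwy : (word_map S (rcons w i) @` K) y.
    by exists y2; rewrite // word_map_rcons y2E.
  exists (rcons w i); split=> //; first by rewrite size_rcons sw.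
  rewrite ltNge; apply/negP => small; apply: nw; exists (rcons w i).
  split=> //; first by case: (w).
  have dE : diam (word_map S (rcons w i) @` K) = r i * diam (word_map S w @` K).
    by rewrite !diam_word /word_ratio -cats1 big_cat big_seq1/=; ring.
  rewrite small andbT dE.
  have [[i0 _] _] := simS i.
  (* One more letter multiplies the diameter by at least the smallest ratio, so the first diameter
     not above [d] still exceeds the lower bound. *)
  have ri : inf (range r) <= r i.
    apply: ge_inf; last by exists i.
    by exists 0 => _ [j _ <-]; have [[/ltW]] := simS j.
  apply: (@le_lt_trans _ _ (r i * d)); first by rewrite mulrC ler_wpM2r// ltW.
  by rewrite ltr_pM2l.
have [k hk] := small_words simS attrK d0.
have [w [sw Kwy dw]] := big k.
have : diam (word_map S w @` K) <= d; last by rewrite leNgt dw.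
by apply: diam_le; [exists y|move=> a b Ka Kb; apply: ltW; exact: (hk w)].
Qed.

(** Along an arc from [z] to [x] the distance to [x] takes the value [s] by the intermediate value
    theorem. The arc meets [x] only at its end, so the portion before avoids [x]. *)
Lemma sphere_crossing x z (s : R) : K x -> K z -> 0 < s < edist x z ->
  exists y, [/\ K y, joined (K `\ x) z y & edist x y = s].
Proof.
move=> Kx Kz /andP[s0 sz].
have zx : z <> x by move=> e; move: sz; rewrite e euclxx; lra.
have [g [[cg ig] g0 g1 Kg]] := arc_of_joined zx (K_joined simS attrK conK Kz Kx).
pose f t := edist x (g t).
have cf : continuous f by exact: (cont_comp cg (@edist_continuous _ _ x)).
have f1 : f 1 = 0 by rewrite /f g1 euclxx.
have f0 : f 0 = edist x z by rewrite /f g0.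
have [||t] := @IVT R f 0 1 s ler01.
- exact: (continuous_subspaceT cf).
- by rewrite f0 f1 min_r ?max_l ?eucl_ge0//; lra.
rewrite in_itv/= => /andP[t0 t1] fts.
exists (g t); split=> //; rewrite -{1}g0; apply: joined_segment => // u.
rewrite (min_idPl t0) (max_idPr t0) => /andP[u0 ut]; split=> //=.
rewrite -g1 => /ig h; have u1 : u = 1 by apply: h; lra.
by move: fts; rewrite (_ : t = 1) ?f1; lra.
Qed.

(** [U] is the part of [K] within a small distance [s] of [x]. The component of each point of [F]
    contains a point at distance exactly [s], and a piece of the right size through it. These pieces
    miss [x], so different components give different maps. *)
Lemma count_pieces x (F : set E) : K x -> finite_set F -> F `<=` K ->
  (forall y, F y -> y <> x) ->
  (forall y z, F y -> F z -> joined (K `\ x) y z -> y = z) ->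
  exists U : set E, [/\ U !=set0, bounded_set U &
    F #<= maps_meeting S r K (1 / 2) U].
Proof.
move=> Kx fF FK Fx FJ.
have [[z0 Fz0]|nF] := pselect (F !=set0); last first.
  have -> : F = set0.
    by apply/seteqP; split=> // y Fy; case: nF; exists y.
  by exists K; split=> //; exact: compact_bounded.
have [D KD] := boundK; have [D' KD'] := boundKw.
have [e e0 he] : exists2 e : R, 0 < e & forall y, F y -> e <= edist x y.
  have : nbhs x (~` (\bigcup_(y in F) [set y])).
    apply: open_nbhs_nbhs; split; last by move=> [y Fy /= xy]; exact: (Fx y Fy).
    rewrite openC; apply: closed_bigcup => // y _.
    by apply: compact_closed; [exact: norm_hausdorff|exact: compact_set1].
  move=> /nbhs_ballP[e /= e0 he]; exists e => // y Fy.
  rewrite leNgt; apply/negP => ye; apply: (he y); last by exists y.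
  by rewrite -ball_normE/=; exact: le_lt_trans (norm_le_eucl _ _) ye.
(* There are countably many words, so [s] can avoid all diameters of pieces; [s < e] puts the points
   of [F] beyond the sphere. *)
pose diams := range (fun w => diam (word_map S w @` K)).
have cdiams : countable diams.
  exact: sub_countable (card_image_le _ _) (countableP _).
have [s [/andP[s0 se] sdiam]] := countable_avoid cdiams e0.
pose U := [set y | K y /\ edist x y <= s].
have Ux : U x by split=> //; rewrite euclxx ltW.
have UD a b : U a -> U b -> edist a b <= 2 * s.
  move=> [_ xa] [_ xb]; have := eucl_triangle x a b; rewrite (euclC a x); lra.
have dU : diam U <= 2 * s by apply: diam_le => //; exists x.
have cross z : F z -> exists y, [/\ K y, joined (K `\ x) z y & edist x y = s].
  move=> Fz; apply: sphere_crossing => //; first exact: FK.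
  by rewrite s0/=; exact: lt_le_trans se (he _ Fz).
have dU0 : s <= diam U.
  have [y [Ky _ ys]] := cross _ Fz0; rewrite -ys.
  by apply: (diam_ge UD) => //; split=> //; rewrite ys.
have dK : e <= diam K.
  apply: le_trans (he _ Fz0) _; apply: (diam_ge KD) => //; exact: FK.
have /choice[phi phiP] z : exists w, F z -> exists y,
    [/\ joined (K `\ x) z y, K y, edist x y = s, (word_map S w @` K) y &
    w != [::] /\ 1 / 2 * diam U * inf (range r) < diam (word_map S w @` K)
                <= 1 / 2 * diam U].
  have [Fz|nFz] := pselect (F z); last by exists [::].
  have [y [Ky zy ys]] := cross _ Fz.
  have [|w [w0 Kwy wd]] := @piece_of_size y (1 / 2 * diam U) Ky; first lra.
  by exists w => _; exists y; split.
(* A piece containing both [x] and [y] has diameter at least [s] and at most half of [2 * s], hence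
   exactly [s], which the choice of [s] excludes. *)
have small z : F z -> ~ (word_map S (phi z) @` K) x.
  move=> /phiP[y [_ _ ys Kwy [_ /andP[_ wd]]]] Kwx.
  have sle : s <= diam (word_map S (phi z) @` K).
    by rewrite -ys; exact: (diam_ge (@KD' (phi z))).
  apply: sdiam; exists (phi z) => //; apply/eqP; rewrite eq_le sle andbT; lra.
exists U; split.
- by exists x.
- have [M [Mr hM]] := compact_bounded compK.
  by exists M; split=> // M' MM' y [Ky _]; exact: (hM M' MM').
(* Equal maps have the same piece, which is path-connected and misses [x]; so [z] and [z'] lie in
   one component and [FJ] identifies them. *)
have inj : {in F &, injective (fun z => word_map S (phi z))}.
  move=> z z' /set_mem Fz /set_mem Fz' zz'.
  have [y [zy Ky ys Kwy _]] := phiP _ Fz.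
  have [y' [zy' Ky' ys' Kwy' _]] := phiP _ Fz'.
  apply: FJ => //; apply: (joined_trans zy); apply: joined_sym.
  apply: (joined_trans zy'); rewrite -zz' in Kwy'.
  have [a' Ka' aE] := Kwy; have [b' Kb' bE] := Kwy'.
  have := joined_image (@word_map_continuous _ _ _ _ _ simS (phi z))
    (K_joined simS attrK conK Kb' Ka').
  rewrite aE bE; apply: joined_sub => t Kwt; split.
    by have [t' Kt' <-] := Kwt; exact: (word_map_K attrK).
  by move=> /= tx; apply: (small z Fz); rewrite -tx.
rewrite -(card_le_eql (inj_card_eq inj)); apply: subset_card_le.
move=> _ [z Fz <-]; have [y [zy Ky ys Kwy [w0 wd]]] := phiP _ Fz.
exists (phi z) => //=; split=> //; exists y; split=> //; split=> //.
by rewrite ys.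
Qed.

End Counting.

(** * Comparison of least cardinals *)

Lemma countable_subset (T : Type) :
  [set: nat] #<= [set: T] -> exists B : set T, B #= [set: nat].
Proof.
elim/Ppointed: T => T.
  rewrite !emptyE => /seteqP[h _].
  by have := h 0%N I.
by move=> /pcard_leTP[f]; exists (range f); exact: card_image.
Qed.

(* When no integer bounds the sizes over all [i], [M] is infinite and any
   countable subset of [T] will do. *)
Lemma least_card_le (T T' I : Type) (Q : I -> set T -> Prop) (M : set T') :
  (forall i, exists B : set T, [/\ Q i B, finite_set B & B #<= M]) ->
  least_card [set B : set T | forall i, exists2 C : set T, Q i C & C #<= B] #<= M.
Proof.
move=> QM; set P := [set B | _].
suff [B [PB cB BM]] : exists B : set T, [/\ P B, countable B & B #<= M].
  exact: card_le_trans ((least_cardP PB cB).2 B PB) BM.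
pose bounded N := forall i, exists2 C : set T, Q i C & C #<= `I_N.
have [[N bN]|nb] := pselect (exists N, bounded N).
  have exN : exists k, `[< bounded k >] by exists N; apply/asboolP.
  case: (ex_minnP exN) => k /asboolP bk kmin.
  have [k0|] := posnP k.
    exists set0; split; [|exact: countable0|exact: cardinality.card_ge0].
    move=> i; have [C QC] := bk i; rewrite k0 => Ck; exists C => //.
    by apply: card_le_trans Ck _; rewrite II0; exact: cardinality.card_ge0.
  case: k bk kmin => // k bk kmin _.
  (* By minimality of [k.+1] some index admits no set of at most [k] elements. The finite set that
     [QM] gives there has at least [k.+1] elements, which suffices at every other index. *)
  have [i hi] : exists i, forall C, Q i C -> `I_k.+1 #<= C \/ ~ finite_set C.
    apply: contrapT => h.
    suff /asboolT/kmin : bounded k by rewrite ltnn.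
    move=> i; apply: contrapT => hi; apply: h; exists i => C QC.
    have [/finite_setP[j Cj]|] := pselect (finite_set C); last by right.
    left; rewrite (card_le_eqr Cj) card_le_II ltnNge; apply/negP => jk.
    by apply: hi; exists C; rewrite // (card_le_eql Cj) card_le_II.
  have [B [QB fB BM]] := QM i; exists B; split=> //; last exact: finite_set_countable.
  move=> j; have [C QC Ck] := bk j; exists C => //.
  by apply: card_le_trans Ck _; have [//|] := hi B QB.
have infM : [set: nat] #<= M.
  apply/infiniteP => /finite_setP[N MN]; apply: nb; exists N => i.
  have [B [QB _ BM]] := QM i; exists B => //.
  by rewrite -(card_le_eqr MN).
have infT : [set: nat] #<= [set: T].
  apply/infiniteP => /finite_setP[N TN]; apply: nb; exists N => i.
  have [B [QB _ _]] := QM i; exists B => //.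
  by rewrite -(card_le_eqr TN); exact: card_leT.
have [B Bn] := countable_subset infT.
exists B; split.
- move=> i; have [C [QC fC _]] := QM i; exists C => //.
  by rewrite (card_le_eqr Bn); exact: finite_set_countable.
- by rewrite /countable (card_le_eql Bn).
- by rewrite (card_le_eql Bn).
Qed.

Unset Implicit Arguments.
Set Strict Implicit.
Set Printing Implicit Defensive.

Theorem theorem3p4 (R : realType) (n m : nat) (r : 'I_m -> R)
    (S : 'I_m -> 'rV[R]_n -> 'rV[R]_n) (K : set 'rV[R]_n) :
  (forall i, similarity (r i) (S i) /\ r i < 1) ->
  weak_separation S ->
  attractor S K ->
  dendrite K ->
  forall x, K x -> menger_order K x #<= calM S r K (1 / 2).
Proof.
move=> simS _ attrK [[_ _ conK] _ noscc] x Kx.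
have calMP U : U !=set0 -> bounded_set U ->
    maps_meeting S r K (1 / 2) U #<= calM S r K (1 / 2).
  rewrite /calM; set P := (X in least_card X).
  (* The set of all word maps is a countable upper bound, so by [least_cardP] the cardinal [calM] is
     itself an upper bound. *)
  have Pw : P (range (word_map S)).
    by move=> V _ _; apply: subset_card_le => _ [w _ <-]; exists w.
  have cw : countable (range (word_map S)).
    exact: sub_countable (card_image_le _ _) (countableP _).
  by move=> U0 bU; apply: (least_cardP Pw cw).1.
(* The order is recast as a least cardinal indexed by the neighbourhoods of [x]; [least_card_le]
   then asks, for each of them, for one finite boundary no larger than [calM]. *)
pose I := {V : set 'rV[R]_n | nbhs x V}.
pose Q (V : I) (B : set 'rV[R]_n) := exists W : set 'rV[R]_n,
  [/\ open W, W x, K `&` W `<=` sval V &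
  boundary_in K (K `&` W) = B].
have QM (V : I) : exists B : set 'rV[R]_n,
    [/\ Q V B, finite_set B & B #<= calM S r K (1 / 2)].
  case: V => V nV.
  have [W [oW Wx WV fbd [bdx bdJ]]] := small_boundary simS attrK conK noscc Kx nV.
  exists (boundary_in K (K `&` W)); split=> //; first by exists W.
  have bdK : boundary_in K (K `&` W) `<=` K by move=> y [[]].
  have [U [U0 bU FU]] := count_pieces simS attrK conK Kx fbd bdK bdx bdJ.
  exact: card_le_trans FU (calMP U U0 bU).
suff -> : menger_order K x =
    least_card [set B : set 'rV[R]_n |
      forall i, exists2 C : set 'rV[R]_n, Q i C & C #<= B].
  exact: least_card_le QM.
congr least_card; apply/seteqP; split=> B /= h.
  move=> [V nV]; have [W [oW Wx WV bB]] := h V nV.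
  by exists (boundary_in K (K `&` W)) => //; exists W.
move=> V nV; have [C [W [oW Wx WV <-]] CB] := h (exist _ V nV).
by exists W.
Qed.
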